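(* Let $f_1,\dots,f_n:\mathbb{R}^d\to\mathbb{R}$ be convex and differentiable, let $f=\frac1n\sum_{i=1}^n f_i$, and let $\mathcal{W}\subseteq\mathbb{R}^d$ be a nonempty convex set (possibly $\mathcal{W}=\mathbb{R}^d$) on which $f$ attains its minimum. Let $\bm{w}^*\in\arg\min_{\bm{w}\in\mathcal{W}}f(\bm{w})$, fix $C>0$, $T\ge 1$ and a clip norm $\tau>0$, and run DP-SGD with constant step size $\eta_t=\eta=\frac{C}{T\tau}\left(\frac1T+\varphi^2\right)^{-1/2}$ for all $t<T$, with noise variance $\sigma_n^2=\frac{\nu T\log(1/\delta)\tau^2}{n^2\varepsilon^2}$. Let $\widehat t$ be the uniformly random index and $\bm{w}_{\widehat t}=\bm{w}_{\mathrm{priv}}$ the output. Then $$\frac1n\sum_{i=1}^n\mathbb{E}\left[\min\left(1,\frac{\tau}{\|\nabla f_i(\bm{w}_{\widehat t})\|}\right)\big(f_i(\bm{w}_{\widehat t})-f_i(\bm{w}^* )\big)\right]\le\left(\frac{\|\bm{w}_0-\bm{w}^*\|^2}{2C}+C\right)\tau\sqrt{\frac1T+\varphi^2}.$$ Suppose moreover that there are constants $0<G_1<G_2<\dots<G_n<\infty$ with $\|\nabla f_i(\bm{w})\|\le G_i$ for all $\bm{w}\in\mathcal{W}$ and all $i\in[n]$, and that each $f_i$ attains its minimum $f_i^*=\min_{\bm{w}\in\mathcal{W}}f_i(\bm{w})$ on $\mathcal{W}$. Then for every clip norm $\tau\in(0,G_n]$, $$\mathrm{OR}(T)\le\frac{1}{\alpha(\tau)}\left(\left(\frac{\|\bm{w}_0-\bm{w}^*\|^2}{2C}+C\right)G_n\sqrt{\frac1T+\varphi^2}\right)+\left(\frac{G_n}{\tau\,\alpha(\tau)}-1\right)\Delta(\bm{w}^*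 ),$$ where $\Delta(\bm{w}^* )\ge 0$ and $\alpha(\tau)\ge 1$ are defined below. In particular, with $T=\frac{1}{3\varphi^2}$ (so $\eta=\frac{3C\varphi}{2\tau}$), $$\mathrm{OR}(T)\le\frac{1}{\alpha(\tau)}\left(\left(\frac{\|\bm{w}_0-\bm{w}^*\|^2}{C}+2C\right)G_n\varphi\right)+\left(\frac{G_n}{\tau\,\alpha(\tau)}-1\right)\Delta(\bm{w}^* ).$$
   Context: For $\bm{z}\in\mathbb{R}^d$ and $c>0$, $\mathrm{clip}(\bm{z},c)=\bm{z}\min(1,c/\|\bm{z}\|)$ (with $\|\cdot\|$ the Euclidean norm, and $\mathrm{clip}(\bm{0},c)=\bm{0}$). DP-SGD on $f=\frac1n\sum_i f_i$ over $\mathcal{W}$: given $\bm{w}_0\in\mathcal{W}$, number of iterations $T$, step sizes $\eta_t$, a parameter $b\ge1$ (sampling probability $b/n$), clip norm $\tau$ and noise variance $\sigma_n^2$: for $t=0,\dots,T-1$, form $\mathcal{S}_t\subseteq[n]$ by including each index independently with probability $b/n$; set $\bm{g}_t=\frac1b\sum_{i\in\mathcal{S}_t}\mathrm{clip}(\nabla f_i(\bm{w}_t),\tau)+\bm{\zeta}_t$ with $\bm{\zeta}_t\sim\mathcal{N}(\bm{0},\sigma_n^2 I_d)$ independent; $\bm{z}_{t+1}=\bm{w}_t-\eta_t\bm{g}_t$; $\bm{w}_{t+1}=\Pi_{\mathcal{W}}(\bm{z}_{t+1})$ (Euclidean projection onto $\mathcal{W}$). Output $\bm{w}_{\mathrm{priv}}=\bm{w}_{\widehat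 t}$ with $\widehat t$ uniform on $\{0,\dots,T-1\}$. Here $\varepsilon>0$, $\delta\in(0,1)$, $\nu>0$ is a fixed absolute constant, and $\varphi=\frac{\sqrt{\nu d\log(1/\delta)}}{n\varepsilon}$. The optimization risk is $\mathrm{OR}(T)=\mathbb{E}[f(\bm{w}_{\mathrm{priv}})]-f(\bm{w}^* )$, expectation over the randomness of the algorithm. With $\Psi=\arg\min_{\bm{w}\in\mathcal{W}}f(\bm{w})$: $\Delta(\bm{w}^* )=\frac1n\sum_{i=1}^n(f_i(\bm{w}^* )-f_i^* )$, and for $\tau\in(0,G_n]$, $$\alpha(\tau)=\inf_{\bm{w}\in\mathcal{W}\setminus\Psi}\frac{\frac1n\sum_{i=1}^n\min\left(\frac1\tau,\frac1{G_i}\right)(f_i(\bm{w})-f_i^* )}{\frac1n\sum_{i=1}^n\frac{f_i(\bm{w})-f_i^*}{G_n}}.$$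
   Formalization: The risk bounds assume that W contains a non-minimizer of f, since otherwise α(τ) is an infimum over the empty set and the bound can fail (f_1=x, f_2=−x on [0,1]); the projection onto W is assumed to exist, and the remark η=3Cφ/(2τ) is not stated. *)

(* Defs.v *)
From HB Require Import structures.
From mathcomp Require Import all_boot all_order all_algebra.
From mathcomp Require Import all_classical all_reals all_analysis.
Set Implicit Arguments. Unset Strict Implicit. Unset Printing Implicit Defensive.
Import Order.TTheory GRing.Theory Num.Theory.
Import numFieldNormedType.Exports.
Local Open Scope ring_scope.
Local Open Scope classical_set_scope.

Section DPSGD.
Variables (R : realType) (d : nat).
Notation vec := 'rV[R]_d.

Definition dotv (u v : vec) : R := \sum_(j < d) u 0 j * v 0 j.
Definition enorm (z : vec) : R := Num.sqrt (dotv z z).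

Definition clip (z : vec) (c : R) : vec :=
  if z == 0 then 0 else Num.min 1 (c / enorm z) *: z.

(* min(1, tau/||g||), with the convention tau/0 = +oo, i.e. value 1 at g = 0 *)
Definition clipfac (tau : R) (g : vec) : R :=
  if g == 0 then 1 else Num.min 1 (tau / enorm g).

Definition is_convex_set (W : set vec) : Prop :=
  forall x y (a : R), W x -> W y -> 0 <= a <= 1 -> W (a *: x + (1 - a) *: y).

Definition is_convex_fun (g : vec -> R) : Prop :=
  forall x y (a : R), 0 <= a <= 1 ->
    g (a *: x + (1 - a) *: y) <= a * g x + (1 - a) * g y.

Definition has_gradient (g : vec -> R) (gr : vec -> vec) : Prop :=
  forall w, differentiable g w /\ forall v, 'd g w v = dotv (gr w) v.

Definition is_proj (W : set vec) (proj : vec -> vec) : Prop :=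
  forall z, W (proj z) /\ forall v, W v -> enorm (z - proj z) <= enorm (z - v).

Definition favg (n : nat) (f : nat -> vec -> R) (w : vec) : R :=
  n%:R^-1 * \sum_(i < n) f i w.

Definition argminW (n : nat) (f : nat -> vec -> R) (W : set vec) : set vec :=
  [set w | W w /\ forall v, W v -> favg n f w <= favg n f v].

(* DP-SGD trajectory for a fixed outcome of the randomness:
   sel t i  = [i \in S_t],  noise t j = j-th coordinate of zeta_t. *)
Fixpoint dpsgd_iter (n : nat) (gf : nat -> vec -> vec) (proj : vec -> vec)
   (eta tau b : R) (sel : nat -> nat -> bool) (noise : nat -> nat -> R)
   (w0 : vec) (t : nat) : vec :=
  match t with
  | 0 => w0
  | t'.+1 =>
    let w := dpsgd_iter n gf proj eta tau b sel noise w0 t' in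
    let g := b^-1 *: (\sum_(i < n | sel t' i) clip (gf i w) tau)
             + \row_(j < d) noise t' j in
    proj (w - eta *: g)
  end.

Definition Delta (n : nat) (f : nat -> vec -> R) (fstar : nat -> R) (ws : vec) : R :=
  n%:R^-1 * \sum_(i < n) (f i ws - fstar i).

(* alpha(tau), with G_n = G (n.-1) (indices are 0-based) *)
Definition alpha (n : nat) (f : nat -> vec -> R) (fstar G : nat -> R)
   (W : set vec) (tau : R) : R :=
  inf [set r | exists w, W w /\ ~ argminW n f W w /\
     r = (n%:R^-1 * \sum_(i < n) Num.min tau^-1 (G i)^-1 * (f i w - fstar i)) /
         (n%:R^-1 * \sum_(i < n) (f i w - fstar i) / G n.-1)].

End DPSGD.

Definition rv_index := ((nat * nat) + (nat * nat) + unit)%type.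

Section Randomness.
Context {R : realType} {d0 : measure_display} {Omega : measurableType d0}.
Variable (P : probability Omega R).
Local Open Scope ereal_scope.

Definition rv_family (B : nat -> nat -> Omega -> bool) (Z : nat -> nat -> Omega -> R)
  (that : Omega -> nat) (k : rv_index) : Omega -> R :=
  match k with
  | inl (inl (t, i)) => fun w => ((B t i w : nat)%:R)%R
  | inl (inr (t, j)) => Z t j
  | inr _ => fun w => ((that w)%:R)%R
  end.

Definition rv_relevant (n d T : nat) (k : rv_index) : bool :=
  match k with
  | inl (inl (t, i)) => (t < T)%N && (i < n)%N
  | inl (inr (t, j)) => (t < T)%N && (j < d)%N
  | inr _ => true
  end.

Definition mutually_independent (rel : rv_index -> bool) (X : rv_index -> Omega -> R) : Prop :=
  forall (s : seq rv_index), uniq s -> all rel s ->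
  forall A : rv_index -> set R, (forall k, measurable (A k)) ->
    P (\bigcap_(k in [set k | k \in s]) (X k @^-1` A k))
    = \prod_(k <- s) P (X k @^-1` A k).

(* The randomness used by DP-SGD with T iterations:
   - B t i (t < T, i < n) : index i is included in S_t, Bernoulli(b/n);
   - Z t j (t < T, j < d) : j-th coordinate of zeta_t, N(0, sigma^2)
     (so zeta_t ~ N(0, sigma^2 I_d));
   - that : the uniform output index on {0,...,T-1};
   all mutually independent. *)
Definition dpsgd_randomness (n d T : nat) (b sigma : R)
  (B : nat -> nat -> Omega -> bool) (Z : nat -> nat -> Omega -> R)
  (that : Omega -> nat) : Prop :=
  [/\ forall k, rv_relevant n d T k -> measurable_fun setT (rv_family B Z that k),
      forall t i, (t < T)%N -> (i < n)%N -> P [set w | B t i w] = (b / n%:R)%:E,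
      forall t j, (t < T)%N -> (j < d)%N -> forall A : set R, measurable A ->
          P (Z t j @^-1` A) = normal_prob 0 sigma A,
      forall k, (k < T)%N -> P [set w | that w = k] = (T%:R^-1)%:E
    & mutually_independent (rv_relevant n d T) (rv_family B Z that)].

End Randomness.

(* Main.v *)
Require Import Defs.
From HB Require Import structures.
From mathcomp Require Import all_boot all_order all_algebra.
From mathcomp Require Import all_classical all_reals all_analysis.
From mathcomp Require Import measurable_realfun ring lra.
Import Order.TTheory GRing.Theory Num.Theory.
Import numFieldNormedType.Exports.
Local Open Scope ring_scope.
Local Open Scope classical_set_scope.
Set Implicit Arguments. Unset Strict Implicit. Unset Printing Implicit Defensive.

(** The iterate [w_t] depends only on the batches and noises of the steps before
    [t], hence is independent of those of step [t] and of the output index. For a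
    nonexpansive map [pi] into [W] with [|z - pi z| <= |z - pi y|], the squared gap
    [|w_t - pi w_t|^2] therefore satisfies the usual projected SGD recursion, in
    which the drift is the inner product of the gap with the mean of the clipped
    gradients over all indices.

    The first bound is the case where [pi] is constantly [wstar]. For the bound on
    the risk, [alpha] controls the excess risk only outside the set [Psi] of
    minimizers, and a constant comparator would leave uncontrolled terms on the
    event that [w_t] lies in [Psi]. Taking for [pi] the projection onto [Psi] makes
    these terms vanish, and gives pointwise
    [f w - f wstar <= k <mean clipped gradient at w, w - pi w> + (k - 1) Delta]
    with [k = G_n / (tau alpha) >= 1]. *)

(** * Euclidean geometry and projections *)

(** The constants leave room for crude second moments. Since [b >= 1], the batch size has E|S_t|^2
    <= b + b^2 <= 2 b^2, and each noise coordinate is only shown to have second moment at most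
    [2 sigma^2]. As [d sigma^2 = T tau^2 phi^2], the error of one step is 2 eta^2 tau^2 T (1/T +
    phi^2), and the choice of [eta] turns the total over [T] steps into 2 C^2; this is the origin of
    the summand [C] in the bounds.

    [W] may be unbounded and the gradients are only assumed to exist, so integrability and
    measurability are genuine obligations: the former is carried along the recursion, the latter
    comes from difference quotients. Independence is used in one form only: a function of some of
    the random coordinates, times a function of one further coordinate, has as integral the product
    of the integrals. *)

Section Euclidean.
Context {R : realType} {d : nat}.
Notation vec := 'rV[R]_d.
Implicit Types u v w x y z : vec.

Lemma dotvC u v : dotv u v = dotv v u.
Proof. by apply: eq_bigr => j _; rewrite mulrC. Qed.

Lemma dotvDl u v w : dotv (u + v) w = dotv u w + dotv v w.
Proof. by rewrite -big_split; apply: eq_bigr => j _; rewrite mxE mulrDl. Qed.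

Lemma dotvZl a u v : dotv (a *: u) v = a * dotv u v.
Proof. by rewrite mulr_sumr; apply: eq_bigr => j _; rewrite mxE mulrA. Qed.

Lemma dotvDr u v w : dotv u (v + w) = dotv u v + dotv u w.
Proof. by rewrite dotvC dotvDl !(dotvC u). Qed.

Lemma dotvZr a u v : dotv u (a *: v) = a * dotv u v.
Proof. by rewrite dotvC dotvZl dotvC. Qed.

Lemma dotvNl u v : dotv (- u) v = - dotv u v.
Proof. by rewrite -scaleN1r dotvZl mulN1r. Qed.

Lemma dotvNr u v : dotv u (- v) = - dotv u v.
Proof. by rewrite dotvC dotvNl dotvC. Qed.

Lemma dotv0l v : dotv 0 v = 0.
Proof. by rewrite -(scale0r 0) dotvZl mul0r. Qed.

Lemma dotv_suml (I : finType) (Q : pred I) (F : I -> vec) v :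
  dotv (\sum_(i | Q i) F i) v = \sum_(i | Q i) dotv (F i) v.
Proof.
by elim/big_rec2 : _ => [|i x y _ <-]; rewrite ?dotv0l ?dotvDl.
Qed.

Lemma dotvv_ge0 u : 0 <= dotv u u.
Proof. by apply: sumr_ge0 => j _; rewrite -expr2 sqr_ge0. Qed.

Lemma dotv_subZ a u v :
  dotv (u - a *: v) (u - a *: v) = dotv u u - 2 * a * dotv u v + a ^+ 2 * dotv v v.
Proof.
by rewrite !(dotvDl, dotvDr, dotvNl, dotvNr, dotvZl, dotvZr) (dotvC v u); ring.
Qed.

Lemma enorm_ge0 u : 0 <= enorm u.
Proof. exact: sqrtr_ge0. Qed.

Lemma sqr_enorm u : enorm u ^+ 2 = dotv u u.
Proof. by rewrite sqr_sqrtr// dotvv_ge0. Qed.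

Lemma coord_le_enorm u j : `|u 0 j| <= enorm u.
Proof.
rewrite -sqrtr_sqr ler_wsqrtr// /dotv (bigD1 j)//= -expr2 lerDl.
by apply: sumr_ge0 => k _; rewrite -expr2 sqr_ge0.
Qed.

Lemma enorm_eq0 u : enorm u = 0 -> u = 0.
Proof.
move=> u0; apply/rowP => j; apply/eqP; rewrite mxE -normr_le0 -u0.
exact: coord_le_enorm.
Qed.

Lemma enorm0 : enorm (0 : vec) = 0.
Proof. by rewrite /enorm dotv0l sqrtr0. Qed.

Lemma enormN u : enorm (- u) = enorm u.
Proof. by rewrite /enorm dotvNl dotvNr opprK. Qed.

Lemma enormBC u v : enorm (u - v) = enorm (v - u).
Proof. by rewrite -enormN opprB. Qed.

Lemma enormZ a u : enorm (a *: u) = `|a| * enorm u.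
Proof. by rewrite /enorm dotvZl dotvZr mulrA -expr2 sqrtrM ?sqr_ge0// sqrtr_sqr. Qed.

Lemma normr_dotv_le u v : `|dotv u v| <= enorm u * enorm v.
Proof.
rewrite -(@ler_pXn2r _ 2)// ?nnegrE ?mulr_ge0 ?enorm_ge0//.
rewrite exprMn !sqr_enorm real_normK ?num_real//.
have [v0|v0] := eqVneq (dotv v v) 0.
  have -> : v = 0 by apply: enorm_eq0; rewrite /enorm v0 sqrtr0.
  by rewrite dotvC !dotv0l mulr0 expr0n.
have vgt0 : 0 < dotv v v by rewrite lt_neqAle eq_sym v0 dotvv_ge0.
(* This squared norm is [dotv v v] times the defect in the Cauchy-Schwarz inequality, so the
   positive factor divides out. *)
have := dotvv_ge0 (dotv v v *: u - dotv u v *: v).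
rewrite !(dotvDl, dotvDr, dotvNl, dotvNr, dotvZl, dotvZr) (dotvC v u) => h.
rewrite -(ler_pM2l vgt0); lra.
Qed.

Lemma dotv_le u v : dotv u v <= enorm u * enorm v.
Proof. exact: le_trans (ler_norm _) (normr_dotv_le u v). Qed.

Lemma enormD u v : enorm (u + v) <= enorm u + enorm v.
Proof.
rewrite -(@ler_pXn2r _ 2)// ?nnegrE ?addr_ge0 ?enorm_ge0//.
rewrite sqr_enorm !(dotvDl, dotvDr) (dotvC v u) sqrrD !sqr_enorm.
have := dotv_le u v; lra.
Qed.

Lemma enorm_sum (I : finType) (Q : pred I) (F : I -> vec) :
  enorm (\sum_(i | Q i) F i) <= \sum_(i | Q i) enorm (F i).
Proof.
elim/big_ind2 : _ => //; first by rewrite enorm0.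
by move=> ? ? ? ? h1 h2; rewrite (le_trans (enormD _ _))// lerD.
Qed.

Lemma ler_enormB u v : `|enorm u - enorm v| <= enorm (u - v).
Proof.
have := enormD (u - v) v; have := enormD (v - u) u.
by rewrite !subrK (enormBC v) => h1 h2; rewrite ler_norml; lra.
Qed.

Lemma coord_le_mx_norm u j : `|u 0 j| <= `|u|.
Proof.
by rewrite [leRHS]/Num.norm/= mx_normrE; apply/bigmax_geP; right; exists (0, j).
Qed.

Lemma mx_norm_le_enorm u : `|u| <= enorm u.
Proof.
rewrite [leLHS]/Num.norm/= mx_normrE; apply/bigmax_leP; split.
  exact: enorm_ge0.
by move=> [i j] _ /=; rewrite ord1 coord_le_enorm.
Qed.

Lemma enorm_le_mx_norm u : enorm u <= d%:R * `|u|.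
Proof.
have -> : u = \sum_j u 0 j *: delta_mx 0 j by exact: row_sum_delta.
rewrite (le_trans (enorm_sum _ _))//.
rewrite -row_sum_delta mulr_natl -[X in _ *+ X](card_ord d) -sumr_const.
apply: ler_sum => j _; rewrite enormZ /enorm /dotv (bigD1 j)//= big1 => [|k kj].
  rewrite !mxE !eqxx mulr1 addr0 sqrtr1 mulr1.
  exact: coord_le_mx_norm.
by rewrite !mxE (negbTE kj) mulr0.
Qed.

(** The topology on row vectors is that of the maximum norm, hence the passage through
    [enorm_le_mx_norm]. Continuity of distances, of nonexpansive maps and of the clipping factor all
    reduces to this criterion. *)
Lemma enorm_lipschitz_continuous (K : R) (h : vec -> R) :
  (forall x y, `|h x - h y| <= K * enorm (x - y)) -> continuous h.
Proof.
move=> hK x; have FF : Filter (nbhs x) := nbhs_filter x.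
apply/cvgrPdist_lt => e e0.
(* The [+ 1] keeps the divisor positive when [K] or [d] is zero. *)
have Kd0 : 0 < `|K| * d%:R + 1 by rewrite ltr_wpDl// mulr_ge0.
have e'0 : 0 < e / (`|K| * d%:R + 1) by rewrite divr_gt0.
apply: (@filterS _ _ FF (ball x (e / (`|K| * d%:R + 1)))) => [y|]; last first.
  exact: (nbhsx_ballx x _ e'0).
rewrite -ball_normE /= => xy.
apply: le_lt_trans (hK _ _) _.
have h1 : K * enorm (x - y) <= (`|K| * d%:R + 1) * `|x - y|.
  apply: (@le_trans _ _ (`|K| * enorm (x - y))).
    by rewrite ler_wpM2r ?enorm_ge0// ler_norm.
  rewrite mulrDl mul1r -mulrA -[leLHS]addr0 lerD//.
  by rewrite ler_wpM2l// enorm_le_mx_norm.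
by apply: le_lt_trans h1 _; rewrite mulrC -ltr_pdivlMr.
Qed.

Lemma continuous_enormB z : continuous (fun x => enorm (z - x)).
Proof.
apply: (@enorm_lipschitz_continuous 1) => x y.
rewrite mul1r (le_trans (ler_enormB _ _))//.
have -> : z - x - (z - y) = y - x by apply/rowP => j; rewrite !mxE; ring.
by rewrite enormBC.
Qed.

End Euclidean.

(** * Nearest-point maps: existence, obtuse-angle inequality, nonexpansiveness *)

Section Projection.
Context {R : realType} {d : nat}.
Notation vec := 'rV[R]_d.
Variables (W : set vec).
Implicit Types (u v w x y z : vec).

Lemma closed_exists_proj : closed W -> W !=set0 -> exists proj, is_proj W proj.
Proof.
move=> Wcl [a Wa].
suff : forall z, exists p, W p /\ forall v, W v -> enorm (z - p) <= enorm (z - v).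
  by move=> /choice[proj Hp]; exists proj.
move=> z.
(* Only points at least as close to [z] as [a] compete, and these form a compact set. *)
pose A := W `&` [set v | enorm (z - v) <= enorm (z - a)].
have A0 : A !=set0 by exists a; split => /=.
have cA : compact A.
  apply: bounded_closed_compact.
    exists (`|z| + enorm (z - a)); split; first exact: num_real.
    move=> M ltM v [_ /= vA]; apply: le_trans (ltW ltM).
    have -> : v = z - (z - v) by rewrite subKr.
    rewrite (le_trans (ler_normB _ _))// lerD2l (le_trans _ vA)//.
    exact: mx_norm_le_enorm.
  apply: closedI => //.
  have -> : [set v | enorm (z - v) <= enorm (z - a)]
    = (fun v => enorm (z - v)) @^-1` [set r | r <= enorm (z - a)] by [].
  by apply: preimage_closed; [move=> x ?; exact: continuous_enormB|exact: closed_le].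
have cf : {within A, continuous (fun v => enorm (z - v))}.
  by apply: continuous_subspaceT => x; exact: continuous_enormB.
have [p Ap pmin] := compact_EVT_min A0 cA cf.
move: Ap; rewrite inE => -[Wp /= pa].
exists p; split => // v Wv.
have [va|/ltW va] := leP (enorm (z - v)) (enorm (z - a)).
  by apply: pmin; rewrite inE.
exact: le_trans pa va.
Qed.

Variable proj : vec -> vec.
Hypotheses (Wconv : is_convex_set W) (Wproj : is_proj W proj).

Lemma projP z : W (proj z). Proof. by case: (Wproj z). Qed.

Lemma proj_obtuse z v : W v -> dotv (z - proj z) (v - proj z) <= 0.
Proof.
move=> Wv; rewrite leNgt; apply/negP.
have key (s : R) : 0 <= s <= 1 ->
    enorm (z - proj z) <= enorm (z - proj z - s *: (v - proj z)).
  have [_ pmin] := Wproj z => /(Wconv Wv (projP z))/pmin.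
  suff -> : z - (s *: v + (1 - s) *: proj z) = z - proj z - s *: (v - proj z) by [].
  by apply/rowP => j; rewrite !mxE; ring.
move: (z - proj z) (v - proj z) key => a c key pos.
have c0 : 0 < dotv c c.
  rewrite lt_neqAle dotvv_ge0 andbT; apply/eqP => c0.
  have {}c0 : c = 0 by apply: enorm_eq0; rewrite /enorm -c0 sqrtr0.
  by move: pos; rewrite c0 dotvC dotv0l ltxx.
(* On [[0, 1]] this [s] minimizes the quadratic |a - s c|^2; with [dotv a c] positive the minimum
   lies strictly below |a|^2, against [key]. *)
pose s := Num.min 1 (dotv a c / dotv c c).
have s0 : 0 < s by rewrite lt_min ltr01 divr_gt0.
have s1 : s <= 1 by rewrite ge_min lexx.
have sc : s * dotv c c <= dotv a c by rewrite -ler_pdivlMr// ge_min lexx orbT.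
have := key s; rewrite (ltW s0) s1 => /(_ isT).
rewrite -(@ler_pXn2r _ 2)// ?nnegrE ?enorm_ge0// !sqr_enorm.
rewrite !(dotvDl, dotvDr, dotvNl, dotvNr, dotvZl, dotvZr) (dotvC c a).
have : s * (s * dotv c c) <= s * dotv a c by rewrite ler_pM2l.
have : 0 < s * dotv a c by rewrite mulr_gt0.
lra.
Qed.

(** Adding the obtuse-angle inequalities at [x] and at [y] bounds the squared left-hand side by <x -
    y, proj x - proj y>; Cauchy-Schwarz finishes. *)
Lemma proj_nonexpansive x y : enorm (proj x - proj y) <= enorm (x - y).
Proof.
have h1 := proj_obtuse x (projP y); have h2 := proj_obtuse y (projP x).
have h : dotv (proj x - proj y) (proj x - proj y) <= dotv (x - y) (proj x - proj y).
  move: h1 h2; rewrite !(dotvDl, dotvDr, dotvNl, dotvNr); lra.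
have [->|n0] := eqVneq (enorm (proj x - proj y)) 0; first exact: enorm_ge0.
have n1 : 0 < enorm (proj x - proj y) by rewrite lt_neqAle eq_sym n0 enorm_ge0.
by rewrite -(ler_pM2r n1) -expr2 sqr_enorm (le_trans h)// dotv_le.
Qed.

Lemma proj_id v : W v -> proj v = v.
Proof.
move=> Wv; have [_ /(_ v Wv)] := Wproj v; rewrite subrr enorm0 => h.
by apply/esym/eqP; rewrite -subr_eq0; apply/eqP/enorm_eq0/le_anti; rewrite h enorm_ge0.
Qed.

Lemma proj_dist_le z v : W v -> enorm (proj z - v) <= enorm (z - v).
Proof. by move=> Wv; rewrite -{1}(proj_id Wv) proj_nonexpansive. Qed.

(** [W] is the zero set of |z - proj z|, a 2-Lipschitz function. The algorithm provides only the map
    [proj]; the closedness extracted from it is what yields a projection onto the set of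
    minimizers. *)
Lemma is_proj_closed : closed W.
Proof.
have -> : W = (fun z => enorm (z - proj z)) @^-1` [set r | r <= 0].
  apply/seteqP; split => [z Wz /=|z /= h]; first by rewrite proj_id// subrr enorm0.
  have /enorm_eq0/eqP : enorm (z - proj z) = 0 by apply/le_anti; rewrite h enorm_ge0.
  by rewrite subr_eq0 => /eqP ->; exact: projP.
apply: preimage_closed; last exact: closed_le.
move=> x _; move: x; apply: (@enorm_lipschitz_continuous _ _ 2) => x y.
rewrite (le_trans (ler_enormB _ _))//.
have -> : x - proj x - (y - proj y) = (x - y) + (proj y - proj x).
  by apply/rowP => j; rewrite !mxE; ring.
rewrite (le_trans (enormD _ _))// [leRHS]mulr_natl mulr2n lerD2l enormBC.
exact: proj_nonexpansive.
Qed.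

End Projection.

(** * Gradients and measurability *)

Section Gradient.
Context {R : realType} {d : nat}.
Notation vec := 'rV[R]_d.
Variables (g : vec -> R) (gr : vec -> vec).
Hypothesis ggr : has_gradient g gr.

Lemma has_gradient_continuous : continuous g.
Proof. by move=> w; apply: differentiable_continuous; case: (ggr w). Qed.

(** Difference quotients along a sequence of increments, so that one statement serves both the
    tangent inequality and the measurability of gradients, where the limit must be countable. *)
Lemma diffquot_cvg (w u : vec) :
  (fun k : nat => k.+1%:R * (g (k.+1%:R^-1 *: u + w) - g w)) @ \oo
    --> dotv (gr w) u.
Proof.
have [dg dE] := ggr w.
have dl : (fun h : R => h^-1 *: ((g \o shift w) (h *: u) - g w)) @ 0^' -->
    dotv (gr w) u.
  by rewrite -dE -deriveE//; exact: diff_derivable.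
have hk : (fun k : nat => k.+1%:R^-1 : R) @ \oo --> 0^'.
  move=> A /= A0.
  have : \forall k \near \oo, (k.+1%:R^-1 : R) != 0 -> A k.+1%:R^-1.
    exact: (@cvg_harmonic R _ A0).
  apply: (@filterS nat \oo) => k; apply.
  by rewrite invr_neq0// pnatr_eq0.
have := cvg_comp _ _ hk dl.
apply: cvg_trans; apply: near_eq_cvg; apply: nearW => k /=.
by rewrite invrK.
Qed.

(** Convexity bounds every difference quotient along [v - w] by [g v - g w], and the bound survives
    in the limit. *)
Lemma convex_gradient_le (w v : vec) : is_convex_fun g ->
  g w + dotv (gr w) (v - w) <= g v.
Proof.
move=> gconv; rewrite -lerBrDl.
have h := diffquot_cvg (w := w) (u := v - w).
rewrite -(cvg_lim _ h)//; apply: limr_le; first by apply/cvg_ex; eexists; exact: h.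
apply: nearW => k.
rewrite -ler_pdivlMl ?ltr0n// lerBlDr.
set a := k.+1%:R^-1.
have a01 : 0 <= a <= 1 by rewrite invr_ge0 ler0n invf_le1 ?ltr0n// ler1n.
have -> : a *: (v - w) + w = a *: v + (1 - a) *: w.
  by apply/rowP => j; rewrite !mxE; ring.
have := gconv v w a a01; lra.
Qed.

End Gradient.

(** * Measurability of vector-valued maps *)

Section MeasurableVector.
Context {R : realType} {d : nat} {d1 : measure_display} {T : measurableType d1}.
Notation vec := 'rV[R]_d.

(** Coordinatewise and over an arbitrary [T]: the same lemmas then apply to [Omega] and to its
    sub-sigma-algebras generated by part of the randomness. *)
Definition measurable_vec (w : T -> vec) :=
  forall j, measurable_fun setT (fun o => w o 0 j).

Lemma measurable_vecD (u v : T -> vec) :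
  measurable_vec u -> measurable_vec v -> measurable_vec (fun o => u o + v o).
Proof.
by move=> mu mv j; under eq_fun do rewrite mxE; exact: measurable_funD.
Qed.

Lemma measurable_vecZ (a : T -> R) (u : T -> vec) :
  measurable_fun setT a -> measurable_vec u -> measurable_vec (fun o => a o *: u o).
Proof.
by move=> mu mv j; under eq_fun do rewrite mxE; exact: measurable_funM.
Qed.

Lemma measurable_vec_cst u : measurable_vec (fun=> u).
Proof. by move=> j; exact: measurable_cst. Qed.

Lemma measurable_vecB (u v : T -> vec) :
  measurable_vec u -> measurable_vec v -> measurable_vec (fun o => u o - v o).
Proof.
move=> mu mv j; under eq_fun do rewrite !mxE; exact: measurable_funB.
Qed.

Lemma measurable_vec_sum (I : Type) (s : seq I) (F : I -> T -> vec) :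
  (forall i, measurable_vec (F i)) -> measurable_vec (fun o => \sum_(i <- s) F i o).
Proof.
move=> mF j; under eq_fun do rewrite summxE.
by apply: measurable_sum => i; exact: mF.
Qed.

Lemma measurable_dotv (u v : T -> vec) : measurable_vec u -> measurable_vec v ->
  measurable_fun setT (fun o => dotv (u o) (v o)).
Proof. by move=> mu mv; apply: measurable_sum => j; exact: measurable_funM. Qed.

(* [h \o w] is the limit of [h] at the discretizations [floor (k w) / k], which take countably many values. *)
Lemma measurable_continuous_comp (w : T -> vec) (h : vec -> R) :
  measurable_vec w -> continuous h -> measurable_fun setT (fun o => h (w o)).
Proof.
move=> mw ch.
pose q k o : 'rV[int]_d := \row_j Num.floor (k.+1%:R * w o 0 j).
pose r k (z : 'rV[int]_d) : vec := \row_j ((z 0 j)%:~R / k.+1%:R).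
have rq k o : `|w o - r k (q k o)| <= k.+1%:R^-1.
  rewrite [leLHS]/Num.norm/= mx_normrE; apply/bigmax_leP; split.
    by rewrite invr_ge0.
  move=> [i j] _ /=; rewrite ord1 !mxE.
  have /andP[h1 h2] := floor_itv (k.+1%:R * w o 0 j).
  have k0 : 0 < k.+1%:R :> R by rewrite ltr0n.
  have -> : w o 0 j - (Num.floor (k.+1%:R * w o 0 j))%:~R / k.+1%:R
    = (k.+1%:R * w o 0 j - (Num.floor (k.+1%:R * w o 0 j))%:~R) / k.+1%:R.
    by rewrite mulrBl mulrAC mulfV ?gt_eqF// mul1r.
  rewrite normrM (ger0_norm (_ : 0 <= k.+1%:R^-1)) ?invr_ge0// ler_piMl ?invr_ge0//.
  by move: h2; rewrite intrD ger0_norm ?subr_ge0// => /ltW; rewrite lerBlDl.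
apply: (@measurable_fun_cvg _ _ _ setT (fun k o => h (r k (q k o)))).
  move=> k _ A mA; rewrite setTI.
  have -> : (fun o => h (r k (q k o))) @^-1` A =
     \bigcup_z ([set o | q k o = z] `&` [set o | A (h (r k z))]).
    apply/seteqP; split => o; last by case => z _ [/= <-].
    by move=> /= Ao; exists (q k o).
  apply: countable_bigcupT_measurable => [|z]; first exact: countableP.
  apply: measurableI; last first.
    have [Az|Az] := pselect (A (h (r k z))).
      by rewrite (_ : [set _ | _] = setT)//; apply/seteqP; split.
    by rewrite (_ : [set _ | _] = set0)//; apply/seteqP; split.
  have -> : [set o | q k o = z] =
     \bigcap_(j in [set: 'I_d]) [set o | Num.floor (k.+1%:R * w o 0 j) = z 0 j].
    apply/seteqP; split => o /=; first by move=> <- j _; rewrite mxE.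
    by move=> oz; apply/rowP => j; rewrite mxE; exact: oz.
  apply: fin_bigcap_measurable => [|j _]; first exact: finite_finset.
  have -> : [set o | Num.floor (k.+1%:R * w o 0 j) = z 0 j] =
     (fun o => k.+1%:R * w o 0 j) @^-1` `[(z 0 j)%:~R, (z 0 j + 1)%:~R[%classic.
    apply/seteqP; split => o /=; rewrite in_itv/= -floor_eq; first by move=> ->.
    by move/eqP.
  rewrite -[X in measurable X]setTI.
  by apply: (measurable_funM (measurable_cst _) (mw j)) => //.
move=> o _ /=.
have rcvg : (fun k => r k (q k o)) @ \oo --> w o.
  apply/cvgrPdist_le => e e0.
  have := @cvg_harmonic R => /cvgrPdist_le/(_ _ e0); apply: filterS => k /=.
  rewrite sub0r normrN ger0_norm ?invr_ge0// => ke.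
  exact: le_trans (rq k o) ke.
apply: (cvg_comp _ _ rcvg); exact: ch.
Qed.

(** Each coordinate of the gradient is a pointwise limit of difference quotients of the continuous
    function [g], so the argument does not go through continuity of [gr]. *)
Lemma measurable_gradient (g : vec -> R) (gr : vec -> vec) (w : T -> vec) :
  has_gradient g gr -> measurable_vec w -> measurable_vec (fun o => gr (w o)).
Proof.
move=> ggr mw j.
have E o : gr (w o) 0 j = dotv (gr (w o)) (delta_mx 0 j).
  rewrite /dotv (bigD1 j)//= big1 => [|i ij].
    by rewrite !mxE !eqxx mulr1 addr0.
  by rewrite !mxE (negbTE ij) mulr0.
under eq_fun do rewrite E.
apply: measurable_fun_cvg => [k|o _]; last exact: (diffquot_cvg ggr).
have cg := has_gradient_continuous ggr.
apply: measurable_funM; first exact: measurable_cst.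
apply: measurable_funB; last exact: measurable_continuous_comp.
apply: (@measurable_continuous_comp (fun o => _ *: _ + w o)) => //.
by apply: measurable_vecD => //; exact: measurable_vec_cst.
Qed.

Lemma measurable_nonexpansive (p : vec -> vec) (w : T -> vec) :
  (forall x y, enorm (p x - p y) <= enorm (x - y)) ->
  measurable_vec w -> measurable_vec (fun o => p (w o)).
Proof.
move=> pne mw j; apply: (measurable_continuous_comp (h := fun v => p v 0 j) mw).
apply: (@enorm_lipschitz_continuous _ _ 1) => x y; rewrite mul1r.
by apply: le_trans (pne x y); apply: le_trans (coord_le_enorm _ j); rewrite !mxE.
Qed.

End MeasurableVector.

(** * Integrals of real random variables *)

Section RealIntegrable.
Context {R : realType} {d0 : measure_display} {Omega : measurableType d0}.
Variable P : probability Omega R.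
Implicit Types f g : Omega -> R.

Definition rintegrable f := P.-integrable setT (EFin \o f).

Lemma rintegrable_measurable f : rintegrable f -> measurable_fun setT f.
Proof. by move=> /integrableP[/measurable_EFinP]. Qed.

Lemma rintegrable_cst r : rintegrable (fun=> r).
Proof. exact: finite_measure_integrable_cst. Qed.

Lemma rintegrableZl a f : rintegrable f -> rintegrable (fun o => a * f o).
Proof.
move=> fi; apply: eq_integrable (integrableZl measurableT a fi) => // o _ /=.
Qed.

Lemma rintegrableD f g :
  rintegrable f -> rintegrable g -> rintegrable (fun o => f o + g o).
Proof.
move=> fi gi; apply: eq_integrable (integrableD measurableT fi gi) => // o _ /=.
Qed.

Lemma rintegrableN f : rintegrable f -> rintegrable (fun o => - f o).
Proof. by move=> /(rintegrableZl (-1)); under eq_fun do rewrite mulN1r. Qed.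

Lemma rintegrableB f g :
  rintegrable f -> rintegrable g -> rintegrable (fun o => f o - g o).
Proof. by move=> fi /rintegrableN; exact: rintegrableD. Qed.

Lemma rintegrable_sum (I : Type) (s : seq I) (Q : pred I) (F : I -> Omega -> R) :
  (forall i, Q i -> rintegrable (F i)) ->
  rintegrable (fun o => \sum_(i <- s | Q i) F i o).
Proof.
move=> iF; elim: s => [|i s ih].
  by under eq_fun do rewrite big_nil; exact: rintegrable_cst.
under eq_fun do rewrite big_cons.
case Qi: (Q i) => //; apply: rintegrableD => //; exact: iF.
Qed.

Lemma le_rintegrable f g : measurable_fun setT f -> (forall o, `|f o| <= g o) ->
  rintegrable g -> rintegrable f.
Proof.
move=> mf fg ig; apply: le_integrable ig => //; first exact/measurable_EFinP.
by move=> o _; rewrite lee_fin (le_trans (fg o))// ler_norm.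
Qed.

Lemma rintegrable_norm f : rintegrable f -> rintegrable (fun o => `|f o|).
Proof.
move=> fi; have mf := rintegrable_measurable fi.
apply: le_integrable fi => //.
  by apply/measurable_EFinP; exact: measurableT_comp.
by move=> o _; rewrite /= normr_id.
Qed.

Lemma Rintegral_cstT r : \int[P]_o r = r.
Proof. by rewrite /Rintegral; have := expectation_cst P r; rewrite unlock => ->. Qed.

Lemma Rintegral_sum (I : Type) (s : seq I) (Q : pred I) (F : I -> Omega -> R) :
  (forall i, Q i -> rintegrable (F i)) ->
  \int[P]_o (\sum_(i <- s | Q i) F i o) = \sum_(i <- s | Q i) \int[P]_o F i o.
Proof.
move=> iF; elim: s => [|i s ih].
  by under eq_Rintegral do rewrite big_nil; rewrite Rintegral_cstT big_nil.
under eq_Rintegral do rewrite big_cons.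
rewrite big_cons; case Qi: (Q i) => //; rewrite RintegralD ?ih//; first exact: iF.
exact: rintegrable_sum.
Qed.

Lemma expectation_Rintegral f : rintegrable f -> ('E_P[f] = (\int[P]_o f o)%:E)%E.
Proof. by move=> fi; rewrite unlock fineK//; exact: integrable_fin_num fi. Qed.

End RealIntegrable.

(** * Moments of the normal distribution *)

Section ExpBounds.
Context {R : realType}.
Implicit Types x y : R.

(** The excess over 2 is (e^(x/2) - e^(-x/2))^2. With [y = x / 4], the inequality [1 + y <= expR y]
    already gives e^(x/2) - e^(-x/2) >= 3y for y >= 0, and (3y)^2 is the quadratic term. The lemma
    turns exponential moments into second moments. *)
Lemma cosh_ge x : 2 + 9 / 16 * x ^+ 2 <= expR x + expR (- x).
Proof.
wlog x0 : x / 0 <= x.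
  move=> H; have [/H//|x0] := leP 0 x.
  by have := H (- x); rewrite oppr_ge0 sqrrN opprK [_ + expR x]addrC => /(_ (ltW x0)).
pose y := x / 4; have y0 : 0 <= y by rewrite divr_ge0.
pose e := expR y ^+ 2.
have ye : (1 + y) ^+ 2 <= e.
  by rewrite ler_pXn2r ?nnegrE ?expR_ge0 ?addr_ge0// expR_ge1Dx.
have e1 : 1 <= e by apply: le_trans ye; rewrite sqrrD; have := sqr_ge0 y; lra.
have e0 : 0 < e by apply: lt_le_trans e1.
have -> : expR x = e ^+ 2.
  by rewrite /e -!expRM_natl; congr expR; rewrite /y; field.
have -> : expR (- x) = (e ^+ 2)^-1.
  by rewrite expRN /e -!expRM_natl; congr (expR _)^-1; rewrite /y; field.
have h : 3 * y <= e - e^-1.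
  suff : 0 <= e^-1 * (e ^+ 2 - 1 - 3 * y * e).
    have -> : e^-1 * (e ^+ 2 - 1 - 3 * y * e) = e - e^-1 - 3 * y.
      by field; rewrite gt_eqF.
    by rewrite subr_ge0.
  rewrite mulr_ge0 ?invr_ge0 ?(ltW e0)//.
  (* In terms of [y] and the slack [q], the quantity is a polynomial with nonnegative
     coefficients. *)
  pose q := e - (1 + y) ^+ 2; have q0 : 0 <= q by rewrite subr_ge0.
  have -> : e = q + (1 + y) ^+ 2 by rewrite subrK.
  have := mulr_ge0 y0 y0; have := mulr_ge0 q0 y0.
  have := mulr_ge0 q0 (mulr_ge0 y0 y0); have := mulr_ge0 q0 q0.
  have := mulr_ge0 y0 (mulr_ge0 y0 y0).
  have := mulr_ge0 (mulr_ge0 y0 y0) (mulr_ge0 y0 y0).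
  lra.
have : (3 * y) ^+ 2 <= (e - e^-1) ^+ 2.
  by rewrite ler_pXn2r ?nnegrE ?mulr_ge0// (le_trans _ h)// mulr_ge0.
have -> : (e - e^-1) ^+ 2 = e ^+ 2 + (e ^+ 2)^-1 - 2.
  by field; rewrite gt_eqF.
have -> : x = 4 * y by rewrite /y; field.
lra.
Qed.

Lemma expR_le_invB x : x < 1 -> expR x <= (1 - x)^-1.
Proof.
move=> x1; rewrite -[x in expR x]opprK expRN lef_pV2 ?posrE ?expR_gt0 ?subr_gt0//.
exact: expR_ge1Dx.
Qed.

(** As [a] tends to 0 the right-hand side is 1 + O(a^2), so the linear term must vanish. It is
    applied with [m] the mean of a centred normal variable. *)
Lemma eq0_of_expR_bound (s m : R) :
  (forall a, 1 + a * m <= expR (a ^+ 2 * s ^+ 2 / 2)) -> m = 0.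
Proof.
move=> H; apply/eqP/negPn/negP => m0.
have m2 : 0 < m ^+ 2 by rewrite exprn_even_gt0.
(* The test value is [a = m / D], with [D] so large that the gain [c * m ^+ 2] outweighs the
   quadratic error. *)
pose D := 1 + s ^+ 2 + m ^+ 2 * s ^+ 2.
have s2 : 0 <= s ^+ 2 by exact: sqr_ge0.
have ms : 0 <= m ^+ 2 * s ^+ 2 by rewrite mulr_ge0// ltW.
have D1 : 1 <= D by rewrite /D; lra.
have D0 : 0 < D by apply: lt_le_trans D1.
pose c := D^-1.
have c0 : 0 < c by rewrite invr_gt0.
have c1 : c <= 1 by rewrite invf_le1.
have cD : c * D = 1 by rewrite mulVf// gt_eqF.
have cms : c * (m ^+ 2 * s ^+ 2) <= 1.
  by rewrite -cD ler_pM2l// /D; lra.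
have ccms : c * (c * (m ^+ 2 * s ^+ 2)) <= c * (m ^+ 2 * s ^+ 2).
  by rewrite -[leRHS]mul1r ler_wpM2r// mulr_ge0// ltW.
have := H (c * m).
have qE : (c * m) ^+ 2 * s ^+ 2 / 2 = c * (c * (m ^+ 2 * s ^+ 2)) / 2 by field.
rewrite qE; set q := c * (c * _) / 2.
have q1 : q < 1 by rewrite /q; lra.
have q0 : 0 < 1 - q by rewrite subr_gt0.
move=> /le_trans /(_ (expR_le_invB q1)).
rewrite -(ler_pM2r q0) mulVf ?gt_eqF//.
have -> : (1 + c * m * m) * (1 - q) =
   1 + (c * m ^+ 2) * (1 - c * s ^+ 2 / 2 - q).
  by rewrite /q; field.
rewrite -[leRHS]addr0 lerD2l leNgt => /negP; apply.
apply: mulr_gt0; first by rewrite mulr_gt0.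
have : c * (s ^+ 2) + c * (m ^+ 2 * s ^+ 2) < 1.
  by rewrite -mulrDr -cD ltr_pM2l// /D; lra.
by rewrite /q; lra.
Qed.

End ExpBounds.

Section NormalMoments.
Context {R : realType}.
Variables (s : R).
Hypothesis s0 : 0 < s.
Notation mu := (@lebesgue_measure R).
Notation N := (normal_prob 0 s).

(** Exponential tilting: e^(ax) times the centred density is, up to a constant, the density with
    mean a s^2. The moment generating function is then read off from total mass 1. *)
Lemma normal_pdf_shift (a x : R) :
  normal_pdf (a * s ^+ 2) s x
  = expR (- (a ^+ 2 * s ^+ 2 / 2)) * (expR (a * x) * normal_pdf 0 s x).
Proof.
rewrite !normal_pdfE ?gt_eqF// /normal_fun.
rewrite [X in _ = _ * X]mulrCA [RHS]mulrCA; congr (_ * _).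
rewrite -!expRD; congr expR; field.
by rewrite gt_eqF.
Qed.

(** The Radon-Nikodym derivative of the normal law and the explicit density have the same integral
    over every measurable set, hence agree almost everywhere. *)
Lemma integral_normal_prob (f : measurableTypeR R -> \bar R) : (forall x, 0 <= f x)%E ->
  measurable_fun setT f ->
  (\int[N]_x f x = \int[mu]_x (f x * (normal_pdf 0 s x)%:E))%E.
Proof.
move=> f0 mf; have dom : N `<< mu := normal_prob_dominates 0 s.
rewrite -(Radon_Nikodym_SigmaFinite.change_of_variables dom f0 measurableT mf).
have mpdf : measurable_fun setT (fun x => (normal_pdf 0 s x)%:E).
  by apply/measurable_EFinP; exact: measurable_normal_pdf.
have mRN := measurable_int _ (Radon_Nikodym_SigmaFinite.f_integrable dom).
apply: ae_eq_integral => //; [exact: emeasurable_funM..|].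
apply: ae_eqe_mul2l; apply: integral_ae_eq => //.
- exact: Radon_Nikodym_SigmaFinite.f_integrable.
- by move=> E _ mE; rewrite -(Radon_Nikodym_SigmaFinite.f_integral dom).
Qed.

Lemma integral_expR_normal (a : R) :
  (\int[N]_x (expR (a * x))%:E = (expR (a ^+ 2 * s ^+ 2 / 2))%:E)%E.
Proof.
rewrite integral_normal_prob; last 2 first.
- by move=> x; rewrite lee_fin expR_ge0.
- by apply/measurable_EFinP/measurableT_comp => //; exact: measurable_funM.
transitivity (\int[mu]_x ((expR (a ^+ 2 * s ^+ 2 / 2))%:E *
  (normal_pdf (a * s ^+ 2) s x)%:E))%E.
  apply: eq_integral => x _; rewrite -!EFinM normal_pdf_shift.
  by congr EFin; rewrite expRN; field; rewrite gt_eqF ?expR_gt0.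
rewrite ge0_integralZl ?integral_normal_pdf ?mule1 ?lee_fin ?expR_ge0//.
- by apply/measurable_EFinP; exact: measurable_normal_pdf.
- by move=> x _; rewrite lee_fin normal_pdf_ge0.
Qed.

Section NormalRV.
Context {d0 : measure_display} {Omega : measurableType d0}.
Variables (P : probability Omega R) (X : Omega -> R).
Hypotheses (mX : measurable_fun setT X)
  (lawX : forall A : set R, measurable A -> P (X @^-1` A) = N A).

Lemma integral_comp_normal (g : R -> R) : (forall x, 0 <= g x) ->
  measurable_fun setT g -> (\int[P]_o (g (X o))%:E = \int[N]_x (g x)%:E)%E.
Proof.
move=> g0 mg; have mEg : measurable_fun setT (EFin \o g) by apply/measurable_EFinP.
have mX' : measurable_fun setT (X : Omega -> measurableTypeR R) := mX.
have := @ge0_integral_pushforward _ _ _ _ R _ mX' P setT (EFin \o g) measurableT.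
rewrite preimage_setT => <-//; last by move=> x _ /=; rewrite lee_fin.
pose X' : {mfun Omega >-> measurableTypeR R} :=
  HB.pack X (isMeasurableFun.Build _ _ _ _ _ mX').
by apply: (@eq_measure_integral _ (measurableTypeR R) R setT N
  (pushforward P X')) => A mA _; exact: lawX.
Qed.

Lemma integral_expR_rv (a : R) :
  (\int[P]_o (expR (a * X o))%:E = (expR (a ^+ 2 * s ^+ 2 / 2))%:E)%E.
Proof.
rewrite -integral_expR_normal.
rewrite (integral_comp_normal (g := fun x => expR (a * x)))//.
- by apply: measurableT_comp => //; exact: measurable_funM.
Qed.

Lemma rintegrable_expR_rv (a : R) : rintegrable P (fun o => expR (a * X o)).
Proof.
apply/integrableP; split.
  by apply/measurable_EFinP/measurableT_comp => //; exact: measurable_funM.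
under eq_integral do rewrite gee0_abs ?lee_fin ?expR_ge0//.
by rewrite integral_expR_rv ltry.
Qed.

Lemma rintegrable_cosh_rv (a : R) :
  rintegrable P (fun o => expR (a * X o) + expR (- (a * X o))).
Proof.
under eq_fun do rewrite -mulNr.
by apply: rintegrableD; exact: rintegrable_expR_rv.
Qed.

(** By [cosh_ge] the square is dominated by exponentials of [X], whose integrals are finite;
    [16 / 9] inverts the coefficient there. *)
Lemma rintegrable_sqr_normal : rintegrable P (fun o => X o ^+ 2).
Proof.
apply: le_rintegrable (rintegrableZl (16 / 9) (rintegrable_cosh_rv 1)).
  exact: measurable_funX.
by move=> o; rewrite !mul1r ger0_norm ?sqr_ge0//; have := cosh_ge (X o); lra.
Qed.

Lemma rintegrable_normal : rintegrable P X.
Proof.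
apply: le_rintegrable (rintegrableD (rintegrable_cst P 1) rintegrable_sqr_normal) => //.
move=> o; rewrite -[X o ^+ 2]real_normK ?num_real//.
by have := sqr_ge0 (`|X o| - 1); have := sqr_ge0 `|X o|; lra.
Qed.

(** Integrating [1 + a * X <= expR (a * X)] bounds [1 + a * m] by the moment generating function for
    every [a], which forces the mean [m] to vanish. *)
Lemma Rintegral_normal : \int[P]_o X o = 0.
Proof.
apply: (@eq0_of_expR_bound _ s) => a.
have iaX := rintegrableZl a rintegrable_normal.
have i1aX := rintegrableD (rintegrable_cst P 1) iaX.
have := le_Rintegral measurableT i1aX (rintegrable_expR_rv a).
have -> : \int[P]_o expR (a * X o) = expR (a ^+ 2 * s ^+ 2 / 2).
  by rewrite /Rintegral integral_expR_rv.
rewrite RintegralD//; last exact: rintegrable_cst.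
rewrite Rintegral_cstT RintegralZl//; last exact: rintegrable_normal.
by apply => o _; exact: expR_ge1Dx.
Qed.

(* [cosh_ge] at [x = X / (3 s)] and the moment generating function; the exact value is [s^2], but the descent estimate has a spare factor 2 on the noise. *)
Lemma Rintegral_sqr_normal_le : \int[P]_o (X o ^+ 2) <= 2 * s ^+ 2.
Proof.
pose a := (3 * s)^-1.
have as_ : a * s = 3^-1 by rewrite /a; field; rewrite gt_eqF.
have i2 := rintegrableZl (9 / 16 * a ^+ 2) rintegrable_sqr_normal.
have i12 := rintegrableD (rintegrable_cst P 2) i2.
have := le_Rintegral measurableT i12 (rintegrable_cosh_rv a).
rewrite RintegralD//; last exact: rintegrable_cst.
rewrite Rintegral_cstT RintegralZl//; last exact: rintegrable_sqr_normal.
have -> : \int[P]_o (expR (a * X o) + expR (- (a * X o))) = 2 * expR (18^-1).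
  under eq_Rintegral do rewrite -mulNr.
  rewrite RintegralD//; [|exact: rintegrable_expR_rv..].
  rewrite /Rintegral !integral_expR_rv /= sqrrN -exprMn as_.
  have -> : 3^-1 ^+ 2 / 2 = 18^-1 :> R by field.
  by rewrite mulr_natl mulr2n.
move=> h.
have {}h : 2 + 9 / 16 * a ^+ 2 * \int[P]_o (X o ^+ 2) <= 2 * expR 18^-1.
  apply: h => o _.
  have -> : 9 / 16 * a ^+ 2 * X o ^+ 2 = 9 / 16 * (a * X o) ^+ 2 by ring.
  exact: cosh_ge.
have e18 : expR 18^-1 <= 18 / 17 :> R.
  have -> : 18 / 17 = (1 - 18^-1)^-1 :> R by field.
  by apply: expR_le_invB; rewrite invf_lt1 ?ltr1n.
have s2 : 0 < s ^+ 2 by rewrite exprn_gt0.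
have aE : a ^+ 2 = (9 * s ^+ 2)^-1 by rewrite /a; field; rewrite gt_eqF.
have {h e18} : (9 * s ^+ 2)^-1 * \int[P]_o (X o ^+ 2) <= 32 / 153.
  by move: h; rewrite aE; lra.
rewrite -ler_pdivlMl ?invr_gt0 ?mulr_gt0// invrK => /le_trans; apply.
lra.
Qed.

End NormalRV.
End NormalMoments.

(** * Independence of the past and the present *)

Section Independence.
Context {R : realType} {d0 : measure_display} {Omega : measurableType d0}.
Variable P : probability Omega R.
Variables (rel : rv_index -> bool) (X : rv_index -> Omega -> R).
Hypotheses (mX : forall k, rel k -> measurable_fun setT (X k))
  (indX : mutually_independent P rel X).

(* They generate the sigma-algebra of the coordinates [X k] with [k] relevant and in [S]. *)
Definition cylinders (S : pred rv_index) : set (set Omega) :=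
  [set E | exists (s : seq rv_index) (A : rv_index -> set R),
     [/\ uniq s, all (predI rel S) s, forall k, measurable (A k)
       & E = \bigcap_(k in [set k | k \in s]) (X k @^-1` A k)]].

Local Notation hist S := (g_sigma_algebraType (cylinders S)).

(** The cylinders must form a pi-system for the uniqueness theorem used in [indep_event]. An index
    occurring in only one of the two lists is constrained by [setT] on the other side. *)
Lemma cylinders_setI S : setI_closed (cylinders S).
Proof.
move=> _ _ [s [A [us alls mA ->]]] [t [A' [ut allt mA' ->]]].
exists (undup (s ++ t)),
  (fun k => (if k \in s then A k else setT) `&` (if k \in t then A' k else setT)).
split; first exact: undup_uniq.
- apply/allP => k; rewrite mem_undup mem_cat => /orP[].
    by move/(allP alls).
  by move/(allP allt).
- by move=> k; apply: measurableI; case: ifP.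
- apply/seteqP; split => o /=.
    move=> [h1 h2] k /=; rewrite mem_undup mem_cat => _; split.
      by case: ifP => // ks; exact: h1.
    by case: ifP => // kt; exact: h2.
  move=> h; split => k /= kst.
    have := h k; rewrite /= mem_undup mem_cat kst => /(_ isT)[] //.
  have := h k; rewrite /= mem_undup mem_cat kst orbT => /(_ isT)[_] //.
Qed.

Lemma cylinders_setT S : cylinders S setT.
Proof.
exists [::], (fun=> setT); split => //.
by apply/seteqP; split => // o _ k.
Qed.

Lemma cylinders_measurable S : cylinders S `<=` measurable.
Proof.
move=> _ [s [A [us alls mA ->]]].
rewrite bigcap_seq big_seq; apply: bigsetI_measurable => k ks.
rewrite -[X in measurable X]setTI; apply: mX => //.
by have /andP[] := allP alls _ ks.
Qed.

Lemma hist_measurable S (E : set Omega) :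
  @measurable _ (hist S) E -> measurable E.
Proof. exact: (smallest_sub (@sigma_algebra_measurable _ Omega) (@cylinders_measurable S)). Qed.

Lemma hist_measurable_fun S d' (T : measurableType d') (Y : Omega -> T) :
  measurable_fun setT (Y : hist S -> T) -> measurable_fun setT Y.
Proof. by move=> mY _ A mA; apply: (@hist_measurable S); exact: mY. Qed.

Lemma hist_sub S S' : {subset S <= S'} ->
  forall E, @measurable _ (hist S) E -> @measurable _ (hist S') E.
Proof.
move=> SS'; apply: sub_smallest2r; first exact: smallest_sigma_algebra.
move=> _ [s [A [us alls mA ->]]]; exists s, A; split => //.
by apply/allP => k /(allP alls) /andP[/= -> /=]; exact: SS'.
Qed.

Lemma hist_sub_fun S S' d' (T : measurableType d') (Y : Omega -> T) :
  {subset S <= S'} ->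
  measurable_fun setT (Y : hist S -> T) -> measurable_fun setT (Y : hist S' -> T).
Proof. by move=> SS' mY _ A mA; apply: (hist_sub SS'); exact: mY. Qed.

Lemma hist_coord (S : pred rv_index) k : rel k -> S k ->
  measurable_fun setT (X k : hist S -> R).
Proof.
move=> rk Sk _ A mA; rewrite setTI; apply: sub_sigma_algebra.
exists [:: k], (fun=> A); split => //=; first by rewrite rk Sk.
apply/seteqP; split => o /=; first by move=> h j; rewrite /= inE => /eqP ->.
by move=> /(_ k); apply; rewrite /= inE.
Qed.

(** Mutual independence speaks of finitely many coordinates only. The measures sending E to P(E and
    X_k in A) and to P(E) P(X_k in A) agree on cylinders, a pi-system, hence on the generated
    sigma-algebra. *)
Lemma indep_event (S : pred rv_index) k (A : set R) (E : set Omega) :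
  rel k -> ~~ S k -> measurable A -> @measurable _ (hist S) E ->
  P (E `&` X k @^-1` A) = (P E * P (X k @^-1` A))%E.
Proof.
move=> rk Sk mA mE.
have mXA : measurable (X k @^-1` A) by rewrite -[X in measurable X]setTI; exact: mX.
pose Q := mscale (NngNum (fine_ge0 (measure_ge0 P (X k @^-1` A)))) P.
have QE F : Q F = (P F * P (X k @^-1` A))%E.
  by rewrite /Q /mscale/= (fineK (fin_num_measure P _ mXA)) muleC.
rewrite -QE.
have -> : P (E `&` X k @^-1` A) = mrestr P mXA E by [].
apply: (g_sigma_algebra_measure_unique (cylinders S) (@cylinders_measurable S)
  (fun=> setT)) => //.
- by move=> _; exact: cylinders_setT.
- by rewrite bigcup_const.
- exact: cylinders_setI.
- move=> F [s [B [us alls mB FE]]]; change (mrestr P mXA F = Q F); rewrite QE.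
  have ks : k \notin s.
    by apply: contra Sk => /(allP alls)/andP[].
  have allk : all rel (k :: s).
    by rewrite /= rk; apply/allP => j /(allP alls)/andP[].
  have alls' : all rel s by apply/allP => j /(allP alls)/andP[].
  have usk : uniq (k :: s) by rewrite /= ks.
  pose B' j := if j == k then A else B j.
  have mB' j : measurable (B' j) by rewrite /B'; case: ifP.
  have := indX usk allk mB'.
  have B'k : B' k = A by rewrite /B' eqxx.
  rewrite big_cons B'k muleC.
  have -> : (\prod_(j <- s) P (X j @^-1` B' j) = P F)%E.
    rewrite FE indX// big_seq [RHS]big_seq; apply: eq_bigr => j js; rewrite /B'.
    by case: eqVneq => // jk; move: ks; rewrite -jk js.
  move=> <-; congr (P _); rewrite FE; apply/seteqP; split => o /=.
    move=> [h1 h2] j /=; rewrite inE /B'; case: eqVneq => [->//|_ /=]; exact: h1.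
  move=> h; split; last by have := h k; rewrite /= inE eqxx /B' eqxx; apply.
  move=> j /= js; have := h j; rewrite /= inE js orbT => /(_ isT).
  by rewrite /B'; case: eqVneq => // jk; move: ks; rewrite -jk js.
- by move=> _; change (P (setT `&` X k @^-1` A) < +oo)%E; rewrite setTI ltey_eq fin_num_measure.
Qed.

(** By [indep_event] the joint law of [Y] and [X k] agrees with the product of their laws on
    rectangles, hence everywhere; Tonelli's theorem then splits the integral. *)
Lemma indep_law (S : pred rv_index) k (Y : Omega -> R) (phi : R -> R) :
  rel k -> ~~ S k -> measurable_fun setT (Y : hist S -> R) ->
  measurable_fun setT phi ->
  (forall y, 0 <= Y y) -> (forall x, 0 <= phi x) ->
  (\int[P]_o (Y o * phi (X k o))%:E
   = (\int[P]_o (Y o)%:E) * (\int[P]_o (phi (X k o))%:E))%E.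
Proof.
move=> rk Sk hY mphi Y0 phi0.
have mY := hist_measurable_fun hY.
have mXk := mX rk.
pose Y' : {mfun Omega >-> R} := HB.pack Y (isMeasurableFun.Build _ _ _ _ _ mY).
pose X' : {mfun Omega >-> R} := HB.pack (X k) (isMeasurableFun.Build _ _ _ _ _ mXk).
have mYX : measurable_fun setT (fun o => (Y o, X k o)) by exact: measurable_fun_pair.
pose YX' : {mfun Omega >-> (R * R)%type} :=
  HB.pack (fun o => (Y o, X k o)) (isMeasurableFun.Build _ _ _ _ _ mYX).
pose muY := distribution P Y'. pose muX := distribution P X'.
pose mu := distribution P YX'.
have muE A : measurable A -> (muY \x muX)%E A = mu A.
  apply: product_measure_unique => B C mB mC.
  change (P (Y @^-1` B `&` X k @^-1` C) = P (Y @^-1` B) * P (X k @^-1` C))%E.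
  apply: (indep_event rk Sk mC).
  by have := hY measurableT _ mB; rewrite setTI.
pose g (z : R * R) := (z.1 * phi z.2)%:E.
have g0 z : (0 <= `|z.1| * phi z.2)%R by rewrite mulr_ge0.
(* The absolute value makes the integrand nonnegative on the whole plane; along [(Y, X k)] it
   changes nothing, as [Y] is nonnegative. *)
pose h (z : R * R) := (`|z.1| * phi z.2)%:E.
have mh : measurable_fun setT h.
  apply/measurable_EFinP/measurable_funM.
    by apply: measurableT_comp => //; exact: measurable_fst.
  by apply: measurableT_comp => //; exact: measurable_snd.
transitivity (\int[mu]_z h z)%E.
  rewrite ge0_integral_pushforward//; last by move=> z _; rewrite lee_fin.
  by apply: eq_integral => o _; rewrite /h /= ger0_norm.
transitivity (\int[muY \x muX]_z h z)%E.
  by apply: eq_measure_integral => A mA _; exact/esym/muE.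
rewrite fubini_tonelli1//; last by move=> z; rewrite lee_fin.
have mEphi : measurable_fun setT (EFin \o phi) by apply/measurable_EFinP.
have -> : (\int[P]_o (phi (X k o))%:E = \int[muX]_x (phi x)%:E)%E.
  by rewrite ge0_integral_pushforward// => x _; rewrite lee_fin.
have -> : (\int[P]_o (Y o)%:E = \int[muY]_x `|x|%:E)%E.
  rewrite ge0_integral_pushforward//; last by apply/measurable_EFinP; exact: normr_measurable.
  by apply: eq_integral => o _; rewrite /= ger0_norm.
transitivity (\int[muY]_x (`|x|%:E * \int[muX]_y (phi y)%:E))%E.
  apply: eq_integral => y _; rewrite /fubini_F /h /=.
  under eq_integral do rewrite EFinM.
  by rewrite ge0_integralZl// => x _; rewrite lee_fin.
apply: ge0_integralZr => //; last by apply: integral_ge0 => x _; rewrite lee_fin.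
by apply/measurable_EFinP; exact: normr_measurable.
Qed.

Lemma rintegrable_indep (S : pred rv_index) k (Y : Omega -> R) (phi : R -> R) :
  rel k -> ~~ S k -> measurable_fun setT (Y : hist S -> R) ->
  measurable_fun setT phi ->
  rintegrable P Y -> rintegrable P (fun o => phi (X k o)) ->
  rintegrable P (fun o => Y o * phi (X k o)).
Proof.
move=> rk Sk hY mphi iY iphi.
have mY := hist_measurable_fun hY.
have mphiX : measurable_fun setT (fun o => phi (X k o)).
  by apply: measurableT_comp => //; exact: mX.
apply/integrableP; split; first by apply/measurable_EFinP; exact: measurable_funM.
under eq_integral do rewrite /= normrM.
rewrite (@indep_law S k (fun o => `|Y o|) (fun x => `|phi x|))//; last 2 first.
- exact: measurableT_comp.
- exact: measurableT_comp.
move/integrableP : iY => [_ iY]; move/integrableP : iphi => [_ iphi].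
by rewrite lte_mul_pinfty// ?integral_ge0// ge0_fin_numE// integral_ge0.
Qed.

(** The signed case follows from the nonnegative one by writing a quantity t as (t + |t|) - |t|,
    first for the function of [X k], then for [Y]. *)
Lemma Rintegral_indep (S : pred rv_index) k (Y : Omega -> R) (phi : R -> R) :
  rel k -> ~~ S k -> measurable_fun setT (Y : hist S -> R) ->
  measurable_fun setT phi ->
  rintegrable P Y -> rintegrable P (fun o => phi (X k o)) ->
  \int[P]_o (Y o * phi (X k o)) = (\int[P]_o Y o) * \int[P]_o phi (X k o).
Proof.
move=> rk Sk.
have pos (W : Omega -> R) (psi : R -> R) :
    measurable_fun setT (W : hist S -> R) -> measurable_fun setT psi ->
    (forall o, 0 <= W o) -> (forall x, 0 <= psi x) ->
    rintegrable P W -> rintegrable P (fun o => psi (X k o)) ->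
    \int[P]_o (W o * psi (X k o)) = (\int[P]_o W o) * \int[P]_o psi (X k o).
  move=> hW mpsi W0 psi0 iW ipsi; rewrite /Rintegral (indep_law rk Sk hW mpsi W0 psi0) fineM//.
    exact: integrable_fin_num iW.
  exact: integrable_fin_num ipsi.
have half (W : Omega -> R) (psi : R -> R) :
    measurable_fun setT (W : hist S -> R) -> measurable_fun setT psi ->
    (forall o, 0 <= W o) ->
    rintegrable P W -> rintegrable P (fun o => psi (X k o)) ->
    \int[P]_o (W o * psi (X k o)) = (\int[P]_o W o) * \int[P]_o psi (X k o).
  move=> hW mpsi W0 iW ipsi.
  have inpsi := rintegrable_norm ipsi.
  have ippsi := rintegrableD ipsi inpsi.
  have mnpsi : measurable_fun setT (fun x => `|psi x|) by exact: measurableT_comp.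
  have mppsi : measurable_fun setT (fun x => psi x + `|psi x|).
    exact: measurable_funD.
  transitivity (\int[P]_o (W o * (psi (X k o) + `|psi (X k o)|) - W o * `|psi (X k o)|)).
    by apply: eq_Rintegral => o _; ring.
  rewrite RintegralB//; last 2 first.
  - exact: (@rintegrable_indep S k W (fun x => psi x + `|psi x|)).
  - exact: (@rintegrable_indep S k W (fun x => `|psi x|)).
  rewrite (pos W (fun x => psi x + `|psi x|))//; last first.
    by move=> x; have := ler_norm (- psi x); rewrite normrN; lra.
  rewrite (pos W (fun x => `|psi x|))// RintegralD//; ring.
move=> hY mphi iY iphi.
have hnY : measurable_fun setT ((fun o => `|Y o|) : hist S -> R).
  exact: measurableT_comp.
have hpY : measurable_fun setT ((fun o => Y o + `|Y o|) : hist S -> R).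
  exact: measurable_funD.
have inY := rintegrable_norm iY.
have ipY := rintegrableD iY inY.
transitivity (\int[P]_o ((Y o + `|Y o|) * phi (X k o) - `|Y o| * phi (X k o))).
  by apply: eq_Rintegral => o _; ring.
rewrite RintegralB//; [|exact: (rintegrable_indep rk Sk)..].
rewrite (half (fun o => Y o + `|Y o|))//; last first.
  by move=> o; have := ler_norm (- Y o); rewrite normrN; lra.
rewrite (half (fun o => `|Y o|))// RintegralD//; ring.
Qed.

End Independence.

(** * Evaluation at the random output index *)

Section NullSet.
Context {R : realType} {d0 : measure_display} {Omega : measurableType d0}.
Variable P : {measure set Omega -> \bar R}.
Import HBNNSimple.
Local Open Scope ereal_scope.

(** [F] and [G] need not be measurable: the integral of a nonnegative function is a supremum over
    simple functions below it. Cutting such a function off on [N] keeps its integral and brings it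
    below [G]. *)
Lemma ge0_le_integral_null (N : set Omega) (F G : Omega -> \bar R) :
  measurable N -> P N = 0 -> (forall o, 0 <= F o) -> (forall o, 0 <= G o) ->
  (forall o, ~ N o -> F o <= G o) -> \int[P]_o F o <= \int[P]_o G o.
Proof.
move=> mN PN F0 G0 FG.
rewrite [leLHS]ge0_integralTE// [leRHS]ge0_integralTE//.
apply: ge_ereal_sup => _ [h hF <-].
pose h' := proj_nnsfun h (measurableC mN).
have h'E o : ~ N o -> h' o = h o.
  by move=> No; rewrite /h' /proj_nnsfun/= mindicE mem_set// mulr1.
have h'N o : N o -> h' o = 0%R.
  by move=> No; rewrite /h' /proj_nnsfun/= mindicE memNset ?mulr0.
have -> : sintegral P h = sintegral P h'.
  rewrite -!integralT_nnsfun; apply: ae_eq_integral => //.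
  - by apply/measurable_EFinP; exact: measurable_funP.
  - by apply/measurable_EFinP; exact: measurable_funP.
  exists N; split => // o /= ho; apply: contrapT => No; apply: ho => _.
  exact: (congr1 EFin (esym (h'E _ No))).
apply: ereal_sup_ubound; exists h' => // o.
have [No|No] := pselect (N o); first by rewrite (h'N _ No).
by rewrite (h'E _ No) (le_trans (hF o))// FG.
Qed.

Lemma eq_integral_null (N : set Omega) (F G : Omega -> \bar R) :
  measurable N -> P N = 0 -> (forall o, ~ N o -> F o = G o) ->
  \int[P]_o F o = \int[P]_o G o.
Proof.
move=> mN PN FG.
rewrite [LHS]integralE [RHS]integralE; congr (_ - _); apply/le_anti/andP; split;
  apply: (@ge0_le_integral_null N) => // o No; rewrite ?funeposE ?funenegE FG//.
Qed.

End NullSet.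

Section RandomIndex.
Context {R : realType} {d0 : measure_display} {Omega : measurableType d0}.
Variable P : probability Omega R.

(* [h t] need not be measurable for [t >= T], so the integrand is only tractable off the null event [that >= T]. *)
Lemma expectation_random_index (T : nat) (that : Omega -> nat) (h : nat -> Omega -> R) :
  (0 < T)%N -> measurable_fun setT (fun o => (that o)%:R : R) ->
  (forall t, (t < T)%N -> P [set o | that o = t] = (T%:R^-1)%:E) ->
  (forall t, (t < T)%N -> rintegrable P (h t)) ->
  (forall t, (t < T)%N -> rintegrable P (fun o => h t o * \1_[set t%:R : R] (that o)%:R)) ->
  (forall t, (t < T)%N -> \int[P]_o (h t o * \1_[set t%:R : R] (that o)%:R)
      = (\int[P]_o h t o) * \int[P]_o (\1_[set t%:R : R] (that o)%:R)) ->
  ('E_P[fun o => h (that o) o] = (T%:R^-1 * \sum_(t < T) \int[P]_o h t o)%:E)%E.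
Proof.
move=> T0 mthat Pthat ih ihI Eh.
have mt (t : nat) : measurable [set o | that o = t].
  have -> : [set o | that o = t] = (fun o => (that o)%:R : R) @^-1` [set t%:R].
    by apply/seteqP; split => o /=; [move=> ->|move/eqP; rewrite eqr_nat => /eqP].
  by rewrite -[X in measurable X]setTI; exact: mthat.
pose N := ~` (\big[setU/set0]_(t < T) [set o | that o = t]).
have mU : measurable (\big[setU/set0]_(t < T) [set o | that o = t]).
  by apply: bigsetU_measurable => t _; exact: mt.
have mN : measurable N by exact: measurableC.
have PN : P N = 0%E.
  have triv : trivIset setT (fun t : 'I_T => [set o | that o = t]).
    by move=> i j _ _ [x [/= ix jx]]; apply/val_inj; rewrite /= -ix -jx.
  have := measure_semi_additive_ord P (fun t : 'I_T => mt t) triv mU.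
  rewrite probability_setC// => ->.
  rewrite (eq_bigr (fun=> (T%:R^-1)%:E)) => [|t _]; last exact: Pthat.
  rewrite sumEFin sumr_const card_ord -[_ *+ T]mulr_natl mulfV ?subee//.
  by rewrite pnatr_eq0 -lt0n.
have indE t o : \1_[set t%:R : R] (that o)%:R = (that o == t)%:R :> R.
  rewrite indicE; have [->|ne] := eqVneq (that o) t; first by rewrite mem_set.
  by rewrite memNset//= => /eqP; rewrite eqr_nat (negbTE ne).
have -> : ('E_P[fun o => h (that o) o] =
  'E_P[fun o => (\sum_(t < T) h t o * \1_[set (t : nat)%:R : R] (that o)%:R)%R])%E.
  rewrite unlock; apply: (eq_integral_null mN PN) => o /contrapT.
  rewrite -(bigcup_mkord T (fun t => [set o | that o = t])) => -[t /= tT oT]; congr EFin.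
  rewrite (bigD1 (Ordinal tT))//= indE oT eqxx mulr1 big1 ?addr0// => s st.
  rewrite -oT indE oT; case: eqP => [ts|_]; last by rewrite mulr0.
  by case/eqP: st; apply/val_inj.
rewrite expectation_Rintegral; last by apply: rintegrable_sum => t _; exact: ihI.
congr EFin; rewrite Rintegral_sum; last by move=> t _; exact: ihI.
rewrite mulr_sumr; apply: eq_bigr => t _; rewrite Eh// mulrC; congr (_ * _).
rewrite /Rintegral; under eq_integral do rewrite indE.
rewrite (_ : (fun o => _) = (fun o => (\1_[set o | that o = t] o)%:E)); last first.
  apply/funext => o; rewrite indicE; have [e|ne] := eqVneq (that o) t.
    by rewrite mem_set.
  by rewrite memNset//= => /eqP; rewrite (negbTE ne).
by rewrite integral_indic// setIT; exact: (congr1 fine (Pthat _ (ltn_ord t))).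
Qed.

End RandomIndex.

(** * Descent *)

Section Clip.
Context {R : realType} {d : nat}.
Notation vec := 'rV[R]_d.
Variable tau : R.
Hypothesis tau0 : 0 < tau.
Implicit Types z : vec.

(** A form without case distinction at [z = 0], whose denominator never drops below [tau]; bounds
    and continuity are immediate from it. *)
Lemma clipfacE z : clipfac tau z = tau / Num.max tau (enorm z).
Proof.
rewrite /clipfac; case: eqVneq => [->|z0].
  by rewrite enorm0 max_l ?ltW// mulfV// gt_eqF.
have ez : 0 < enorm z.
  by rewrite lt_neqAle enorm_ge0 andbT eq_sym; apply: contra_neq z0; exact: enorm_eq0.
case: (leP tau (enorm z)) => h.
  by rewrite min_r// ler_pdivrMr// mul1r.
by rewrite min_l ?mulfV ?gt_eqF// ler_pdivlMr// mul1r ltW.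
Qed.

Lemma clipE z : clip z tau = clipfac tau z *: z.
Proof. by rewrite /clip /clipfac; case: eqVneq => // ->; rewrite scaler0. Qed.

Lemma clipfac_ge0 z : 0 <= clipfac tau z.
Proof. by rewrite clipfacE divr_ge0 ?le_max ?(ltW tau0). Qed.

Lemma clipfac_le1 z : clipfac tau z <= 1.
Proof.
by rewrite clipfacE ler_pdivrMr ?lt_max ?tau0// mul1r le_max lexx.
Qed.

Lemma enorm_clip_le z : enorm (clip z tau) <= tau.
Proof.
rewrite clipE enormZ ger0_norm ?clipfac_ge0// clipfacE mulrAC ler_pdivrMr ?lt_max ?tau0//.
by rewrite ler_pM2l// le_max lexx orbT.
Qed.

Lemma continuous_clipfac : continuous (clipfac tau : vec -> R).
Proof.
apply: (@enorm_lipschitz_continuous _ _ tau^-1) => x y; rewrite !clipfacE.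
set a := Num.max _ _; set b := Num.max _ _.
have ta : tau <= a by rewrite le_max lexx.
have tb : tau <= b by rewrite le_max lexx.
have a0 : 0 < a by apply: lt_le_trans ta.
have b0 : 0 < b by apply: lt_le_trans tb.
have ab : `|b - a| <= enorm (x - y).
  apply: le_trans (ler_enormB _ _); rewrite distrC /a /b ler_norml.
  have := ler_norm (enorm x - enorm y); have := ler_norm (enorm y - enorm x).
  rewrite (distrC (enorm y)); move: ( `|_ - _| ) => N.
  by case: (leP tau (enorm x)) => hx; case: (leP tau (enorm y)) => hy; lra.
have -> : tau / a - tau / b = tau * (b - a) / (a * b).
  by field; rewrite !gt_eqF.
rewrite !normrM (gtr0_norm tau0) normfV (gtr0_norm (_ : 0 < a * b)) ?mulr_gt0//.
rewrite ler_pdivrMr ?mulr_gt0//.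
have tab : tau ^+ 2 <= a * b by rewrite expr2 ler_pM// ltW.
apply: (@le_trans _ _ (tau^-1 * enorm (x - y) * tau ^+ 2)).
  have -> : tau^-1 * enorm (x - y) * tau ^+ 2 = tau * enorm (x - y).
    by field; rewrite gt_eqF.
  by rewrite ler_pM2l.
by rewrite ler_wpM2l// mulr_ge0 ?enorm_ge0// invr_ge0 ltW.
Qed.

End Clip.

(** The mean of the batch gradient at a fixed [v]: the inclusion probability [b / n] cancels the
    normalization [b^-1]. *)
Definition mean_clipped_grad {R : realType} {d : nat} (n : nat)
    (gf : nat -> 'rV[R]_d -> 'rV[R]_d) (tau : R) (v : 'rV[R]_d) : 'rV[R]_d :=
  n%:R^-1 *: \sum_(i < n) clip (gf i v) tau.

(** * The iterates as functions of the randomness *)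

Section SGD.
Context {R : realType} {d n T : nat} {d0 : measure_display} {Omega : measurableType d0}.
Notation vec := 'rV[R]_d.
Variables (gf : nat -> vec -> vec) (f : nat -> vec -> R) (W : set vec)
  (proj : vec -> vec) (w0 : vec) (eta tau b sigma : R)
  (P : probability Omega R) (B : nat -> nat -> Omega -> bool)
  (Z : nat -> nat -> Omega -> R) (that : Omega -> nat).
Hypotheses (n0 : (0 < n)%N) (tau0 : 0 < tau) (b1 : 1 <= b) (eta0 : 0 <= eta)
  (sigma0 : 0 < sigma) (hf : forall i, (i < n)%N -> has_gradient (f i) (gf i))
  (Wconv : is_convex_set W) (Wproj : is_proj W proj) (Ww0 : W w0)
  (rnd : dpsgd_randomness P n d T b sigma B Z that).

Local Notation rel := (rv_relevant n d T).
Local Notation X := (rv_family B Z that).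
Local Notation hist S := (g_sigma_algebraType (cylinders rel X S)).

Definition iterate t o :=
  dpsgd_iter n gf proj eta tau b (fun t i => B t i o) (fun t j => Z t j o) w0 t.
Local Notation w := iterate.

Definition before t : pred rv_index := fun k => match k with
  | inl (inl (s, _)) => (s < t)%N | inl (inr (s, _)) => (s < t)%N | inr _ => false end.

(** Two stages per step are needed: the batch of step [t] meets functions of [before t], whereas its
    noise meets the displaced gap, which already involves that batch. Both stages exclude the output
    index. *)
Definition before_noise t : pred rv_index := fun k => match k with
  | inl (inl (s, _)) => (s <= t)%N | inl (inr (s, _)) => (s < t)%N | inr _ => false end.

Definition batch t i o : R := (B t i o)%:R.
Definition clipped_grad i t o := clip (gf i (w t o)) tau.
Definition batch_grad t o :=
  b^-1 *: \sum_(i < n) batch t i o *: clipped_grad i t o.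
Definition noise_vec t o : vec := \row_j Z t j o.

Let b0 : 0 < b. Proof. exact: lt_le_trans b1. Qed.

Let mX k : rel k -> measurable_fun setT (X k).
Proof. by case: rnd => + _ _ _ _; apply. Qed.

Let indX : mutually_independent P rel X.
Proof. by case: rnd. Qed.

Lemma iterateS t o :
  w t.+1 o = proj (w t o - eta *: (batch_grad t o + noise_vec t o)).
Proof.
have -> : batch_grad t o = b^-1 *: \sum_(i < n | B t i o) clipped_grad i t o.
  rewrite /batch_grad [in RHS]big_mkcond /=; congr (_ *: _); apply: eq_bigr => i _.
  by rewrite /batch; case: (B t i o); rewrite ?scale1r ?scale0r.
by [].
Qed.

Lemma iterate_in t o : W (w t o).
Proof. by case: t => [|t] //; rewrite iterateS; exact: (projP Wproj). Qed.

Lemma before_sub t : {subset before t <= before_noise t}.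
Proof. by move=> [[[s i]|[s j]]|[]]//; rewrite !unfold_in /= => /ltnW. Qed.

Lemma before_noise_sub t : {subset before_noise t <= before t.+1}.
Proof. by move=> [[[s i]|[s j]]|[]]//; rewrite !unfold_in /= => /ltnW. Qed.

Lemma measurable_vec_sub (S S' : pred rv_index) (u : Omega -> vec) :
  {subset S <= S'} ->
  measurable_vec (u : hist S -> vec) -> measurable_vec (u : hist S' -> vec).
Proof. by move=> SS' mu j; exact: (hist_sub_fun SS' (mu j)). Qed.

Lemma measurable_clipped_grad d1 (T1 : measurableType d1) (u : T1 -> vec) i :
  (i < n)%N -> measurable_vec u -> measurable_vec (fun o => clip (gf i (u o)) tau).
Proof.
move=> ni mu; have mg := measurable_gradient (hf ni) mu.
under [X in measurable_vec X]eq_fun do rewrite clipE.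
apply: measurable_vecZ => //.
exact: (measurable_continuous_comp mg (continuous_clipfac tau0)).
Qed.

Lemma measurable_batch_grad t : (t < T)%N ->
  measurable_vec (w t : hist (before_noise t) -> vec) ->
  measurable_vec (batch_grad t : hist (before_noise t) -> vec).
Proof.
move=> tT mw; apply: (measurable_vecZ (measurable_cst b^-1)).
apply: measurable_vec_sum => i; apply: measurable_vecZ.
  apply: (@hist_coord _ _ _ rel X _ (inl (inl (t, i : nat)))) => //=.
  by rewrite tT ltn_ord.
exact: measurable_clipped_grad.
Qed.

Lemma measurable_iterate t : (t <= T)%N ->
  measurable_vec (w t : hist (before t) -> vec).
Proof.
elim: t => [|t ih] tT; first exact: measurable_vec_cst.
have mw := measurable_vec_sub (@before_sub t) (ih (ltnW tT)).
have mx := measurable_vec_sub (@before_noise_sub t) (measurable_batch_grad tT mw).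
have {}mw := measurable_vec_sub (@before_noise_sub t) mw.
rewrite (_ : w t.+1 = fun o => proj (w t o - eta *: (batch_grad t o + noise_vec t o))).
  2: by apply/funext => o; exact: iterateS.
apply: (measurable_nonexpansive (proj_nonexpansive Wconv Wproj)).
apply: measurable_vecB => //.
apply: (measurable_vecZ (measurable_cst eta)); apply: measurable_vecD => // j.
under eq_fun do rewrite mxE.
apply: (@hist_coord _ _ _ rel X _ (inl (inr (t, j : nat)))) => //=.
by rewrite tT ltn_ord.
Qed.

Lemma batch_measurable t i : (t < T)%N -> (i < n)%N -> measurable_fun setT (batch t i).
Proof. by move=> tT ni; apply: (mX (k := inl (inl (t, i)))); rewrite /= tT. Qed.

Lemma batch01 t i o : 0 <= batch t i o <= 1.
Proof. by rewrite /batch; case: (B t i o); rewrite ?lexx ?ler01. Qed.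

Lemma rintegrable_batch t i : (t < T)%N -> (i < n)%N -> rintegrable P (batch t i).
Proof.
move=> tT ni; apply: le_rintegrable (rintegrable_cst P 1).
  exact: batch_measurable.
by move=> o; have /andP[h1 h2] := batch01 t i o; rewrite ger0_norm.
Qed.

Lemma Rintegral_batch t i : (t < T)%N -> (i < n)%N ->
  \int[P]_o batch t i o = b / n%:R.
Proof.
move=> tT ni; have [_ PB _ _ _] := rnd.
have mB : measurable [set o | B t i o].
  have := batch_measurable tT ni measurableT (measurable_set1 1).
  rewrite setTI; congr measurable; apply/seteqP; split => o /=; rewrite /batch.
    by case: (B t i o) => //= /eqP; rewrite eq_sym oner_eq0.
  by move=> ->.
have -> : batch t i = \1_[set o | B t i o].
  apply/funext => o; rewrite indicE /batch; case: (boolP (B t i o)) => h.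
    by rewrite mem_set.
  by rewrite memNset//=; apply/negP.
by rewrite /Rintegral integral_indic// setIT; exact: (congr1 fine (PB t i tT ni)).
Qed.

Lemma Rintegral_batchM t i k : (t < T)%N -> (i < n)%N -> (k < n)%N -> i != k ->
  \int[P]_o (batch t i o * batch t k o) = (b / n%:R) ^+ 2.
Proof.
move=> tT ni nk ik.
rewrite (Rintegral_indep mX indX (S := pred1 (inl (inl (t, i))))
  (k := inl (inl (t, k))) (phi := id)) //=.
- by rewrite !Rintegral_batch// expr2.
- by rewrite tT.
- by apply: contra ik => /eqP[->].
- by apply: (@hist_coord _ _ _ rel X _ (inl (inl (t, i)))); rewrite /= ?tT ?eqxx.
- exact: rintegrable_batch.
- exact: rintegrable_batch.
Qed.

Definition batch_size_sqr t o := (\sum_(i < n) batch t i o) ^+ 2.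

Lemma batch_size_sqrE t o :
  batch_size_sqr t o = \sum_(i < n) \sum_(k < n) batch t i o * batch t k o.
Proof.
by rewrite /batch_size_sqr expr2 mulr_suml; apply: eq_bigr => i _; rewrite mulr_sumr.
Qed.

Lemma rintegrable_batchM t i k : (t < T)%N -> (i < n)%N -> (k < n)%N ->
  rintegrable P (fun o => batch t i o * batch t k o).
Proof.
move=> tT ni nk; apply: le_rintegrable (rintegrable_batch tT ni).
  by apply: measurable_funM; exact: batch_measurable.
move=> o; have /andP[h1 h2] := batch01 t i o; have /andP[h3 h4] := batch01 t k o.
by rewrite ger0_norm ?mulr_ge0// ler_piMr.
Qed.

Lemma rintegrable_batch_size_sqr t : (t < T)%N -> rintegrable P (batch_size_sqr t).
Proof.
move=> tT.
have -> : batch_size_sqr t = fun o => \sum_(i < n) \sum_(k < n) batch t i o * batch t k o.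
  by apply/funext => o; exact: batch_size_sqrE.
by apply: rintegrable_sum => i _; apply: rintegrable_sum => k _; exact: rintegrable_batchM.
Qed.

(** Diagonal products are indicators with mean [b / n], the others have mean [(b / n) ^+ 2]; the
    total is at most [b + b ^+ 2], and [b >= 1] absorbs the first term. *)
Lemma Rintegral_batch_size_sqr_le t : (t < T)%N ->
  \int[P]_o batch_size_sqr t o <= 2 * b ^+ 2.
Proof.
move=> tT; have nn0 : (n%:R : R) != 0 by rewrite pnatr_eq0 -lt0n.
under eq_Rintegral do rewrite batch_size_sqrE.
rewrite Rintegral_sum; last first.
  by move=> i _; apply: rintegrable_sum => k _; exact: rintegrable_batchM.
apply: (@le_trans _ _ (\sum_(i < n) (b / n%:R + b ^+ 2 / n%:R))).
  apply: ler_sum => i _; rewrite Rintegral_sum; last first.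
    by move=> k _; exact: rintegrable_batchM.
  rewrite (bigD1 i)//= lerD//.
    under eq_Rintegral => o _.
      rewrite (_ : batch t i o * batch t i o = batch t i o); last first.
        by rewrite /batch; case: (B t i o); rewrite ?mulr1 ?mulr0.
      over.
    by rewrite Rintegral_batch.
  rewrite (eq_bigr (fun=> (b / n%:R) ^+ 2)) => [|k ki]; last first.
    by rewrite Rintegral_batchM// eq_sym.
  (* The square for [k = i] is added so that there are exactly [n] equal terms. *)
  rewrite (_ : b ^+ 2 / n%:R = \sum_(k < n) (b / n%:R) ^+ 2); last first.
    by rewrite sumr_const card_ord -[RHS]mulr_natl; field.
  rewrite [leRHS](bigD1 i)//= lerDr; exact: sqr_ge0.
rewrite sumr_const card_ord -[_ *+ n]mulr_natl.
have -> : n%:R * (b / n%:R + b ^+ 2 / n%:R) = b + b ^+ 2 by field.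
by have : b * 1 <= b * b; [rewrite ler_pM2l|rewrite mulr1 expr2; lra].
Qed.

Let mZ t j : (t < T)%N -> (j < d)%N -> measurable_fun setT (Z t j).
Proof. by move=> tT jd; apply: (mX (k := inl (inr (t, j)))); rewrite /= tT. Qed.

Let lawZ t j (A : set R) : (t < T)%N -> (j < d)%N -> measurable A ->
  P (Z t j @^-1` A) = normal_prob 0 sigma A.
Proof. by move=> tT jd; case: rnd => _ _ + _ _; apply. Qed.

(** * One-step recursion against a moving comparator *)

Section Comparator.
Variable pi : vec -> vec.
Hypotheses (piW : forall z, W (pi z))
  (pi_nonexp : forall y z, enorm (pi y - pi z) <= enorm (y - z))
  (pi_dist : forall y z, enorm (z - pi z) <= enorm (z - pi y)).

Definition gap t o := w t o - pi (w t o).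
Definition gap_half t o := gap t o - eta *: batch_grad t o.
Definition sqdist t o := dotv (gap t o) (gap t o).

(** The square is expanded so that each cross term is a sum of products of an earlier quantity and
    one fresh coordinate; the squared batch gradient is replaced by its bound through the batch
    size. *)
Definition sqdist_bound t o :=
  sqdist t o
  - 2 * eta * b^-1 * (\sum_(i < n) dotv (clipped_grad i t o) (gap t o) * batch t i o)
  + (eta * b^-1 * tau) ^+ 2 * batch_size_sqr t o
  - 2 * eta * (\sum_(j < d) gap_half t o 0 j * Z t j o)
  + eta ^+ 2 * (\sum_(j < d) Z t j o ^+ 2).

Lemma enorm_batch_grad_le t o :
  enorm (batch_grad t o) <= b^-1 * (tau * \sum_(i < n) batch t i o).
Proof.
rewrite enormZ ger0_norm ?invr_ge0 ?(ltW b0)// ler_pM2l ?invr_gt0//.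
apply: le_trans (enorm_sum _ _) _; rewrite mulr_sumr; apply: ler_sum => i _.
have /andP[h1 h2] := batch01 t i o.
by rewrite enormZ ger0_norm// mulrC ler_wpM2r// enorm_clip_le.
Qed.

Lemma sqdistS_le t o : sqdist t.+1 o <= sqdist_bound t o.
Proof.
pose z := w t o - eta *: (batch_grad t o + noise_vec t o).
have -> : sqdist t.+1 o = enorm (proj z - pi (proj z)) ^+ 2.
  by rewrite sqr_enorm /sqdist /gap iterateS.
(* [pi_dist] exchanges the comparator of the new iterate for that of the old one; the latter lies in
   [W], so projecting [z] onto [W] does not move it farther away. *)
apply: (@le_trans _ _ (enorm (z - pi (w t o)) ^+ 2)).
  rewrite ler_pXn2r ?nnegrE ?enorm_ge0//.
  by apply: le_trans (pi_dist (w t o) _) _; exact: (proj_dist_le Wconv Wproj).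
have -> : z - pi (w t o) = gap_half t o - eta *: noise_vec t o.
  by apply/rowP => j; rewrite /z /gap_half /gap !mxE; ring.
have noiseE : dotv (gap_half t o) (noise_vec t o) = \sum_(j < d) gap_half t o 0 j * Z t j o.
  by apply: eq_bigr => j _; rewrite !mxE.
have noise2 : dotv (noise_vec t o) (noise_vec t o) = \sum_(j < d) Z t j o ^+ 2.
  by apply: eq_bigr => j _; rewrite !mxE expr2.
have bg : dotv (batch_grad t o) (gap t o) =
    b^-1 * \sum_(i < n) dotv (clipped_grad i t o) (gap t o) * batch t i o.
  rewrite dotvZl dotv_suml; congr (_ * _); apply: eq_bigr => i _.
  by rewrite dotvZl mulrC.
have bb : dotv (batch_grad t o) (batch_grad t o)
    <= (b^-1 * tau) ^+ 2 * batch_size_sqr t o.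
  rewrite -sqr_enorm /batch_size_sqr -exprMn -mulrA.
  rewrite ler_pXn2r ?nnegrE ?enorm_ge0 ?enorm_batch_grad_le//.
  exact: le_trans (enorm_ge0 _) (enorm_batch_grad_le t o).
have -> : sqdist_bound t o = sqdist t o - 2 * eta * dotv (batch_grad t o) (gap t o)
    + eta ^+ 2 * ((b^-1 * tau) ^+ 2 * batch_size_sqr t o)
    - 2 * eta * dotv (gap_half t o) (noise_vec t o)
    + eta ^+ 2 * dotv (noise_vec t o) (noise_vec t o).
  by rewrite /sqdist_bound noiseE noise2 bg; ring.
rewrite sqr_enorm.
have : eta ^+ 2 * dotv (batch_grad t o) (batch_grad t o)
    <= eta ^+ 2 * ((b^-1 * tau) ^+ 2 * batch_size_sqr t o).
  by rewrite ler_wpM2l// sqr_ge0.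
have hh : dotv (gap_half t o) (gap_half t o) = sqdist t o
    - 2 * eta * dotv (batch_grad t o) (gap t o)
    + eta ^+ 2 * dotv (batch_grad t o) (batch_grad t o).
  by rewrite /gap_half dotv_subZ (dotvC (gap t o)).
rewrite dotv_subZ hh; lra.
Qed.

Let pi_m d1 (T1 : measurableType d1) (u : T1 -> vec) :
  measurable_vec u -> measurable_vec (fun o => u o - pi (u o)).
Proof. by move=> mu; apply: measurable_vecB => //; exact: measurable_nonexpansive. Qed.

Let mw t : (t <= T)%N -> measurable_vec (w t).
Proof. by move=> tT j; exact: (hist_measurable_fun mX (measurable_iterate tT j)). Qed.

Lemma measurable_sqdist t : (t <= T)%N -> measurable_fun setT (sqdist t).
Proof. by move=> tT; apply: measurable_dotv; apply: pi_m; exact: mw. Qed.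

Lemma enorm_gap_le t o : enorm (gap t o) <= 1 + sqdist t o.
Proof.
rewrite /sqdist -sqr_enorm.
have := sqr_ge0 (enorm (gap t o) - 1); have := sqr_ge0 (enorm (gap t o)); lra.
Qed.

Lemma normr_dotv_clipped_le t i o (v : vec) :
  `|dotv (clipped_grad i t o) v| <= tau * enorm v.
Proof.
apply: le_trans (normr_dotv_le _ _) _.
by rewrite ler_wpM2r ?enorm_ge0// enorm_clip_le.
Qed.

Lemma hist_dotv_clipped t i : (t < T)%N -> (i < n)%N ->
  measurable_fun setT
    ((fun o => dotv (clipped_grad i t o) (gap t o)) : hist (before t) -> R).
Proof.
move=> tT ni; have mh := measurable_iterate (ltnW tT).
by apply: measurable_dotv; [exact: measurable_clipped_grad|exact: pi_m].
Qed.

Lemma rintegrable_dotv_clipped t i : (t < T)%N -> (i < n)%N ->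
  rintegrable P (sqdist t) ->
  rintegrable P (fun o => dotv (clipped_grad i t o) (gap t o)).
Proof.
move=> tT ni iD.
apply: le_rintegrable (rintegrableZl tau (rintegrableD (rintegrable_cst P 1) iD)).
  exact: (hist_measurable_fun mX (hist_dotv_clipped tT ni)).
move=> o; apply: le_trans (normr_dotv_clipped_le _ _ _ _) _.
by rewrite ler_pM2l// enorm_gap_le.
Qed.

Let batch_indep t i : (t < T)%N -> (i < n)%N -> rintegrable P (sqdist t) ->
  rintegrable P (fun o => dotv (clipped_grad i t o) (gap t o) * batch t i o) /\
  \int[P]_o (dotv (clipped_grad i t o) (gap t o) * batch t i o)
  = (\int[P]_o dotv (clipped_grad i t o) (gap t o)) * (b / n%:R).
Proof.
move=> tT ni iD; have hc := hist_dotv_clipped tT ni.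
have ic := rintegrable_dotv_clipped tT ni iD.
have rk : rel (inl (inl (t, i))) by rewrite /= tT.
have Sk : ~~ before t (inl (inl (t, i))) by rewrite /= ltnn.
split.
  exact: (rintegrable_indep mX indX rk Sk hc (@measurable_id _ _ setT) ic
    (rintegrable_batch tT ni)).
rewrite -(Rintegral_batch tT ni).
exact: (Rintegral_indep mX indX rk Sk hc (@measurable_id _ _ setT) ic
  (rintegrable_batch tT ni)).
Qed.

Let noise_indep t (j : 'I_d) : (t < T)%N -> rintegrable P (sqdist t) ->
  rintegrable P (fun o => gap_half t o 0 j * Z t j o) /\
  \int[P]_o (gap_half t o 0 j * Z t j o) = 0.
Proof.
move=> tT iD.
have mh := measurable_vec_sub (@before_sub t) (measurable_iterate (ltnW tT)).
have hv : measurable_vec (gap_half t : hist (before_noise t) -> vec).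
  apply: measurable_vecB; first exact: pi_m.
  by apply: (measurable_vecZ (measurable_cst eta)); exact: measurable_batch_grad.
have hg := hv j.
have ig : rintegrable P (fun o => gap_half t o 0 j).
  have i1 := rintegrableD (rintegrable_cst P 1) iD.
  have ib : rintegrable P (fun o => \sum_(i < n) batch t i o).
    by apply: rintegrable_sum => i _; exact: rintegrable_batch.
  apply: le_rintegrable (rintegrableD i1 (rintegrableZl (eta * (b^-1 * tau)) ib)).
    exact: (hist_measurable_fun mX hg).
  move=> o; apply: le_trans (coord_le_enorm _ _) _.
  apply: le_trans (enormD _ _) _; apply: lerD; first exact: enorm_gap_le.
  rewrite enormN enormZ ger0_norm// -mulrA ler_wpM2l// -mulrA.
  exact: enorm_batch_grad_le.
have rk : rel (inl (inr (t, j : nat))) by rewrite /= tT ltn_ord.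
have Sk : ~~ before_noise t (inl (inr (t, j : nat))) by rewrite /= ltnn.
have mZj := mZ tT (ltn_ord j).
have lZj A := lawZ (A := A) tT (ltn_ord j).
have iZ := rintegrable_normal sigma0 mZj lZj.
split.
  exact: (rintegrable_indep mX indX rk Sk hg (@measurable_id _ _ setT) ig iZ).
rewrite -[RHS](mulr0 (\int[P]_o gap_half t o 0 j)) -(Rintegral_normal sigma0 mZj lZj).
exact: (Rintegral_indep mX indX rk Sk hg (@measurable_id _ _ setT) ig iZ).
Qed.

Definition descent t := n%:R^-1 *
  \sum_(i < n) \int[P]_o dotv (clipped_grad i t o) (gap t o).

Lemma sqdist_bound_integral t : (t < T)%N -> rintegrable P (sqdist t) ->
  rintegrable P (sqdist_bound t) /\
  \int[P]_o sqdist_bound t o <= \int[P]_o sqdist t o - 2 * eta * descent t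
     + eta ^+ 2 * (2 * tau ^+ 2 + 2 * d%:R * sigma ^+ 2).
Proof.
move=> tT iD.
have nn0 : (n%:R : R) != 0 by rewrite pnatr_eq0 -lt0n.
have i1 : rintegrable P (fun o =>
    \sum_(i < n) dotv (clipped_grad i t o) (gap t o) * batch t i o).
  by apply: rintegrable_sum => i _; exact: (batch_indep tT (ltn_ord i) iD).1.
have i2 := rintegrable_batch_size_sqr tT.
have i3 : rintegrable P (fun o => \sum_(j < d) gap_half t o 0 j * Z t j o).
  by apply: rintegrable_sum => j _; exact: (noise_indep j tT iD).1.
have iZ2 (j : 'I_d) : rintegrable P (fun o => Z t j o ^+ 2).
  by apply: (rintegrable_sqr_normal sigma0 (mZ tT (ltn_ord j))) => A; exact: lawZ.
have i4 : rintegrable P (fun o => \sum_(j < d) Z t j o ^+ 2).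
  by apply: rintegrable_sum => j _; exact: iZ2.
have j1 := rintegrableZl (2 * eta * b^-1) i1.
have j2 := rintegrableZl ((eta * b^-1 * tau) ^+ 2) i2.
have j3 := rintegrableZl (2 * eta) i3.
have j4 := rintegrableZl (eta ^+ 2) i4.
have k1 := rintegrableB iD j1.
have k2 := rintegrableD k1 j2.
have k3 := rintegrableB k2 j3.
have k4 := rintegrableD k3 j4.
split; first exact: k4.
rewrite /sqdist_bound RintegralD// RintegralB// RintegralD// RintegralB//.
rewrite !RintegralZl//.
have e1 : \int[P]_o (\sum_(i < n) dotv (clipped_grad i t o) (gap t o) * batch t i o)
    = b * descent t.
  rewrite Rintegral_sum => [|i _]; last exact: (batch_indep tT (ltn_ord i) iD).1.
  rewrite /descent mulrA mulr_sumr; apply: eq_bigr => i _.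
  by rewrite (batch_indep tT (ltn_ord i) iD).2 mulrC.
have e3 : \int[P]_o (\sum_(j < d) gap_half t o 0 j * Z t j o) = 0.
  rewrite Rintegral_sum => [|j _]; last exact: (noise_indep j tT iD).1.
  by apply: big1 => j _; exact: (noise_indep j tT iD).2.
have e4 : \int[P]_o (\sum_(j < d) Z t j o ^+ 2) <= 2 * d%:R * sigma ^+ 2.
  rewrite Rintegral_sum => [|j _]; last exact: iZ2.
  apply: (@le_trans _ _ (\sum_(j < d) 2 * sigma ^+ 2)).
    apply: ler_sum => j _.
    by apply: (Rintegral_sqr_normal_le sigma0 (mZ tT (ltn_ord j))) => A; exact: lawZ.
  by rewrite sumr_const card_ord -[_ *+ d]mulr_natl; lra.
have e2 : (eta * b^-1 * tau) ^+ 2 * \int[P]_o batch_size_sqr t o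
    <= eta ^+ 2 * (2 * tau ^+ 2).
  have -> : eta ^+ 2 * (2 * tau ^+ 2) = (eta * b^-1 * tau) ^+ 2 * (2 * b ^+ 2).
    by field; rewrite gt_eqF.
  by rewrite ler_wpM2l ?sqr_ge0// Rintegral_batch_size_sqr_le.
have {}e4 := ler_wpM2l (sqr_ge0 eta) e4.
rewrite e1 e3; set D := \int[P]_o sqdist t o.
have -> : 2 * eta * b^-1 * (b * descent t) = 2 * eta * descent t.
  by field; rewrite gt_eqF.
by rewrite mulr0 subr0 mulrDr; lra.
Qed.

(** With [W] possibly unbounded, integrability has to be propagated: at step [t] it makes
    [sqdist_bound t] integrable, and this dominates the next squared gap. *)
Lemma rintegrable_sqdist t : (t <= T)%N -> rintegrable P (sqdist t).
Proof.
elim: t => [|t ih] tT.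
  exact: (rintegrable_cst P (dotv (w0 - pi w0) (w0 - pi w0))).
have [ib _] := sqdist_bound_integral tT (ih (ltnW tT)).
apply: le_rintegrable ib; first exact: measurable_sqdist.
by move=> o; rewrite ger0_norm ?dotvv_ge0// sqdistS_le.
Qed.

Lemma sum_descent_le : 2 * eta * (\sum_(t < T) descent t) <=
  dotv (w0 - pi w0) (w0 - pi w0)
  + T%:R * (eta ^+ 2 * (2 * tau ^+ 2 + 2 * d%:R * sigma ^+ 2)).
Proof.
set K := eta ^+ 2 * _.
suff : forall t, (t <= T)%N -> \int[P]_o sqdist t o
    <= dotv (w0 - pi w0) (w0 - pi w0) - 2 * eta * (\sum_(s < t) descent s) + t%:R * K.
  move=> /(_ T (leqnn T)).
  have : 0 <= \int[P]_o sqdist T o by apply: Rintegral_ge0 => o _; exact: dotvv_ge0.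
  lra.
elim=> [|t ih] tT.
  rewrite big_ord0 mulr0 mul0r subr0 addr0 /sqdist /gap /iterate /=.
  by rewrite Rintegral_cstT.
have iD := rintegrable_sqdist (ltnW tT).
have [ib le2] := sqdist_bound_integral tT iD.
have le1 : \int[P]_o sqdist t.+1 o <= \int[P]_o sqdist_bound t o.
  apply: le_Rintegral => //; first exact: rintegrable_sqdist.
  by move=> o _; exact: sqdistS_le.
rewrite big_ord_recr /= -natr1; have := ih (ltnW tT); move: le1 le2; rewrite -/K; lra.
Qed.

(** Converts a pointwise inequality on [W] into one for averages over the iterations. The first
    bound takes [k = 1] and [c = 0], the risk bound takes the constants of [risk_le]. *)
Lemma mean_descent_le (h : vec -> R) (k c : R) : 0 <= k -> (0 < T)%N ->
  (forall x, W x -> h x <= k * dotv (mean_clipped_grad n gf tau x) (x - pi x) + c) ->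
  (forall t, (t < T)%N -> rintegrable P (fun o => h (w t o))) ->
  T%:R^-1 * (\sum_(t < T) \int[P]_o h (w t o))
    <= k * (T%:R^-1 * \sum_(t < T) descent t) + c.
Proof.
move=> k0 T0 hle ih.
have T_gt0 : 0 < T%:R :> R by rewrite ltr0n.
rewrite mulrCA -(ler_pM2l T_gt0) mulrDr !(mulrCA _ T%:R^-1) !mulKf ?gt_eqF//.
have -> : T%:R * c = \sum_(t < T) c by rewrite sumr_const card_ord mulr_natl.
rewrite mulr_sumr -big_split /=; apply: ler_sum => t _.
have tT := ltn_ord t; have iD := rintegrable_sqdist (ltnW tT).
have ic (i : 'I_n) := rintegrable_dotv_clipped tT (ltn_ord i) iD.
have is_ : rintegrable P (fun o => \sum_(i < n) dotv (clipped_grad i t o) (gap t o)).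
  by apply: rintegrable_sum => i _; exact: ic.
have id_ := rintegrableZl k (rintegrableZl n%:R^-1 is_).
have -> : k * descent t + c = \int[P]_o
    (k * (n%:R^-1 * \sum_(i < n) dotv (clipped_grad i t o) (gap t o)) + c).
  rewrite RintegralD//; last exact: rintegrable_cst.
  rewrite Rintegral_cstT RintegralZl//; last exact: rintegrableZl.
  by rewrite RintegralZl// Rintegral_sum.
apply: le_Rintegral => //; first exact: ih.
  exact: (rintegrableD id_ (rintegrable_cst P c)).
move=> o _; apply: le_trans (hle _ (iterate_in t o)) _.
by rewrite /mean_clipped_grad dotvZl dotv_suml.
Qed.

End Comparator.

(** Linear growth suffices because the squared distance to the fixed point [v] is integrable: it is
    [sqdist] for the constant comparator. *)
Lemma rintegrable_iterate (h : vec -> R) (v : vec) (K L : R) t :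
  W v -> 0 <= K -> (forall x, W x -> `|h x| <= K * enorm (x - v) + L) ->
  (t <= T)%N -> measurable_fun setT (fun o => h (w t o)) ->
  rintegrable P (fun o => h (w t o)).
Proof.
move=> Wv K0 hle tT mh.
have iD : rintegrable P (sqdist (fun=> v) t).
  by apply: rintegrable_sqdist => // y z; rewrite subrr enorm0 enorm_ge0.
have i1 := rintegrableZl K (rintegrableD (rintegrable_cst P 1) iD).
apply: le_rintegrable (rintegrableD i1 (rintegrable_cst P L)) => // o.
apply: le_trans (hle _ (iterate_in t o)) _; rewrite lerD2r ler_wpM2l//.
exact: enorm_gap_le.
Qed.

Lemma measurable_iterateT (h : vec -> R) t :
  measurable_fun setT ((fun o => h (w t o)) : hist (before t) -> R) ->
  measurable_fun setT (fun o => h (w t o)).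
Proof. exact: (hist_measurable_fun mX). Qed.

Lemma expectation_output (h : vec -> R) : (0 < T)%N ->
  (forall t, (t < T)%N ->
     measurable_fun setT ((fun o => h (w t o)) : hist (before t) -> R)) ->
  (forall t, (t < T)%N -> rintegrable P (fun o => h (w t o))) ->
  ('E_P[fun o => h (w (that o) o)]
    = (T%:R^-1 * \sum_(t < T) \int[P]_o h (w t o))%:E)%E.
Proof.
move=> T0 mh ih; have rk : rel (inr tt) by [].
have mphi (t : nat) : measurable_fun setT (\1_[set t%:R : R] : R -> R).
  exact: measurable_indic.
have mthat : measurable_fun setT (fun o => (that o)%:R : R) := mX rk.
have iphi (t : nat) : rintegrable P (fun o => \1_[set t%:R : R] (that o)%:R).
  apply: le_rintegrable (rintegrable_cst P 1).
    exact: (measurableT_comp (mphi t) mthat).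
  by move=> o; rewrite indicE; case: (_ \in _); rewrite ?normr1 ?normr0.
apply: (expectation_random_index (h := fun t o => h (w t o))) => //.
- by case: rnd.
- move=> t tT; apply: (rintegrable_indep mX indX rk _ (mh t tT) (mphi t)) => //.
  exact: ih.
- move=> t tT; apply: (Rintegral_indep mX indX rk _ (mh t tT) (mphi t)) => //.
  exact: ih.
Qed.

End SGD.

(** * The ratio [alpha] *)

Section RiskDecomposition.
Context {R : realType} {d n : nat}.
Notation vec := 'rV[R]_d.
Variables (f : nat -> vec -> R) (gf : nat -> vec -> vec) (W : set vec)
  (wstar : vec).
Hypotheses (n0 : (0 < n)%N)
  (hf : forall i, (i < n)%N -> is_convex_fun (f i) /\ has_gradient (f i) (gf i))
  (Wws : W wstar) (wsmin : forall v, W v -> favg n f wstar <= favg n f v).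

Let n_gt0 : 0 < n%:R^-1 :> R. Proof. by rewrite invr_gt0 ltr0n. Qed.

Lemma argminWE : argminW n f W = W `&` [set v | favg n f v <= favg n f wstar].
Proof.
apply/seteqP; split => v [Wv vmin]; split => //=; first exact: vmin.
by move=> u Wu; apply: le_trans vmin (wsmin Wu).
Qed.

Lemma favg_convex : is_convex_fun (favg n f).
Proof.
move=> x y a a01; rewrite /favg !mulrA !(mulrC _ n%:R^-1) -!mulrA -mulrDr.
rewrite ler_pM2l// !mulr_sumr -big_split /=; apply: ler_sum => i _.
by case: (hf (ltn_ord i)) => + _; apply.
Qed.

Lemma favg_continuous : continuous (favg n f).
Proof.
have cs (s : seq 'I_n) : continuous (fun v => \sum_(i <- s) f i v).
  elim: s => [|i s ih] x.
    by under eq_fun do rewrite big_nil; exact: cst_continuous.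
  have FF : Filter (nbhs x) := nbhs_filter x.
  under eq_fun do rewrite big_cons.
  apply: cvgD; last exact: ih.
  by case: (hf (ltn_ord i)) => _ /has_gradient_continuous; apply.
move=> x; have FF : Filter (nbhs x) := nbhs_filter x.
by apply: cvgM; [exact: cst_continuous|exact: cs].
Qed.

Lemma argminW_closed : closed W -> closed (argminW n f W).
Proof.
move=> Wcl; rewrite argminWE; apply: closedI => //.
have -> : [set v | favg n f v <= favg n f wstar]
  = favg n f @^-1` [set r | r <= favg n f wstar] by [].
by apply: preimage_closed; [move=> x _; exact: favg_continuous|exact: closed_le].
Qed.

Lemma argminW_convex : is_convex_set W -> is_convex_set (argminW n f W).
Proof.
move=> Wconv; rewrite argminWE => x y a [Wx /= fx] [Wy /= fy] a01; split.
  exact: Wconv.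
have /andP[a0 a1] := a01.
apply: le_trans (favg_convex _ _ a01) _.
have h1 := ler_wpM2l a0 fx.
have h2 : (1 - a) * favg n f y <= (1 - a) * favg n f wstar.
  by rewrite ler_wpM2l// subr_ge0.
lra.
Qed.

Variables (tau : R) (G fstar : nat -> R).
Hypotheses (tau0 : 0 < tau) (G0 : 0 < G 0%N)
  (Ginc : forall i j, (i < j)%N -> (j < n)%N -> G i < G j)
  (Gbound : forall i v, (i < n)%N -> W v -> enorm (gf i v) <= G i)
  (fsP : forall i, (i < n)%N ->
     (exists u, W u /\ f i u = fstar i) /\ (forall v, W v -> fstar i <= f i v))
  (tauG : tau <= G n.-1) (nonmin : exists v, W v /\ ~ argminW n f W v).

Local Notation al := (alpha n f fstar G W tau).
Local Notation De := (Delta n f fstar wstar).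
Local Notation Gn := (G n.-1).

(** [excess / Gn] and [wexcess] are the denominator and the numerator in [alpha]. Unlike the risk,
    [excess] measures each [f i] against its own minimum; the two differ by the constant [Delta]. *)
Definition excess v := n%:R^-1 * \sum_(i < n) (f i v - fstar i).
Definition wexcess v :=
  n%:R^-1 * \sum_(i < n) Num.min tau^-1 (G i)^-1 * (f i v - fstar i).
Local Notation mean_clipped := (mean_clipped_grad n gf tau).

Lemma G_gt0 i : (i < n)%N -> 0 < G i.
Proof.
by case: i => [//|i] ni; apply: lt_trans G0 _; exact: Ginc.
Qed.

Lemma Gn_gt0 : 0 < Gn. Proof. by apply: G_gt0; rewrite prednK. Qed.

Lemma G_le i : (i < n)%N -> G i <= Gn.
Proof.
move=> ni; have [->//|ne] := eqVneq i n.-1; apply/ltW/Ginc; last by rewrite prednK.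
by rewrite ltn_neqAle ne -ltnS prednK.
Qed.

Lemma f_excess_ge0 i v : (i < n)%N -> W v -> 0 <= f i v - fstar i.
Proof. by move=> ni Wv; rewrite subr_ge0; case: (fsP ni) => _; apply. Qed.

Lemma Delta_ge0 : 0 <= De.
Proof.
apply: mulr_ge0; first exact: ltW.
by apply: sumr_ge0 => i _; exact: f_excess_ge0.
Qed.

Lemma excessE v : excess v = favg n f v - favg n f wstar + De.
Proof. by rewrite /excess /Delta /favg !sumrB; ring. Qed.

Lemma excess_gt0 v : W v -> ~ argminW n f W v -> 0 < excess v.
Proof.
move=> Wv; rewrite argminWE => /not_andP[//|/negP]; rewrite -ltNge => lt.
by rewrite excessE; have := Delta_ge0; lra.
Qed.

(** The weights lie between [1 / Gn] and [1 / tau]; this bound and [wexcess_le] confine the ratio,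
    and hence [alpha], to the interval from 1 to [Gn / tau]. *)
Lemma wexcess_ge v : W v -> Gn^-1 * excess v <= wexcess v.
Proof.
move=> Wv; rewrite mulrCA ler_pM2l// mulr_sumr; apply: ler_sum => i _.
have ni := ltn_ord i.
rewrite ler_wpM2r ?f_excess_ge0// le_min !lef_pV2 ?posrE ?tau0 ?Gn_gt0 ?(G_gt0 ni)//.
by rewrite tauG G_le.
Qed.

Lemma wexcess_le v : W v -> wexcess v <= tau^-1 * excess v.
Proof.
move=> Wv; rewrite [leRHS]mulrCA ler_pM2l// mulr_sumr; apply: ler_sum => i _.
by rewrite ler_wpM2r ?f_excess_ge0// ge_min lexx.
Qed.

Definition alpha_ratio v := wexcess v / (Gn^-1 * excess v).

Lemma alphaE : al = inf [set alpha_ratio v | v in [set v | W v /\ ~ argminW n f W v]].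
Proof.
rewrite /alpha; congr inf; apply/seteqP; split => r /=.
  move=> [v [Wv [vn ->]]]; exists v => //; congr (_ / _).
  by rewrite /excess -mulr_suml; ring.
move=> [v [Wv vn] <-]; exists v; split => //; split => //; congr (_ / _).
by rewrite /excess -mulr_suml; ring.
Qed.

Lemma alpha_ge1 : 1 <= al.
Proof.
(* [nonmin] supplies an element; the infimum of the empty set would be the default value 0. *)
rewrite alphaE; apply: lb_le_inf; first by case: nonmin => v vP; exists (alpha_ratio v), v.
move=> _ [v [Wv vn] <-]; rewrite ler_pdivlMr ?mul1r ?wexcess_ge//.
by rewrite mulr_gt0 ?invr_gt0 ?Gn_gt0 ?excess_gt0.
Qed.

Lemma alpha_le v : W v -> ~ argminW n f W v -> al * (Gn^-1 * excess v) <= wexcess v.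
Proof.
move=> Wv vn.
have pos : 0 < Gn^-1 * excess v by rewrite mulr_gt0 ?invr_gt0 ?Gn_gt0 ?excess_gt0.
rewrite -ler_pdivlMr// alphaE; apply: ge_inf; last by exists v.
(* The infimum is a lower bound only for a set bounded below, and 1 is such a bound. *)
exists 1 => _ [u [Wu un] <-]; rewrite ler_pdivlMr ?mul1r ?wexcess_ge//.
by rewrite mulr_gt0 ?invr_gt0 ?Gn_gt0 ?excess_gt0.
Qed.

(** This is what makes the coefficient of [Delta] in the risk bound nonnegative. *)
Lemma alpha_le_ratio : al <= Gn / tau.
Proof.
case: nonmin => v [Wv vn].
have F0 := excess_gt0 Wv vn.
have h := le_trans (alpha_le Wv vn) (wexcess_le Wv).
rewrite -(ler_pM2r F0); move: h.
by rewrite mulrCA ler_pdivrMl ?Gn_gt0// => h; rewrite -[leRHS]mulrA.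
Qed.

(** The weight times [tau] is min(1, tau / G_i), at most the clipping factor since [G i] bounds the
    gradient. Splitting [f i v - fstar i] at [f i p], the first part is controlled by convexity and
    the second by the clipping factor being at most 1. *)
Lemma tau_wexcess_le v p : W v -> W p ->
  tau * wexcess v <= dotv (mean_clipped v) (v - p) + excess p.
Proof.
move=> Wv Wp; rewrite mulrCA dotvZl dotv_suml -mulrDr ler_pM2l//.
rewrite mulr_sumr -big_split /=; apply: ler_sum => i _.
have ni := ltn_ord i; have [fconv fgr] := hf ni.
have Gi := G_gt0 ni.
have c1 : tau * Num.min tau^-1 (G i)^-1 <= clipfac tau (gf i v).
  rewrite clipfacE// ler_pM2l//.
  have m0 : 0 < Num.max tau (enorm (gf i v)) by rewrite lt_max tau0.
  have [mt|mg] := leP (enorm (gf i v)) tau.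
    by rewrite ge_min lexx.
  rewrite ge_min; apply/orP; right.
  by rewrite lef_pV2 ?posrE ?Gi ?(lt_trans tau0)// Gbound.
have h1 : tau * (Num.min tau^-1 (G i)^-1 * (f i v - fstar i)) <=
    clipfac tau (gf i v) * (f i v - fstar i).
  by rewrite mulrA ler_wpM2r// f_excess_ge0.
apply: le_trans h1 _.
have h2 : clipfac tau (gf i v) * (f i v - f i p) <= dotv (clip (gf i v) tau) (v - p).
  rewrite clipE dotvZl ler_wpM2l ?clipfac_ge0//.
  have := convex_gradient_le fgr v p fconv.
  by rewrite -(opprB v p) dotvNr; lra.
have h3 : clipfac tau (gf i v) * (f i p - fstar i) <= f i p - fstar i.
  by rewrite ler_piMl ?f_excess_ge0// clipfac_le1.
lra.
Qed.

Lemma risk_le v p : W v -> argminW n f W p -> (argminW n f W v -> p = v) ->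
  favg n f v - favg n f wstar <=
  Gn / (tau * al) * dotv (mean_clipped v) (v - p) + (Gn / (tau * al) - 1) * De.
Proof.
move=> Wv; rewrite {1}argminWE => -[Wp /= pmin] pv.
have al0 : 0 < al := lt_le_trans ltr01 alpha_ge1.
set k := Gn / (tau * al).
have k1 : 1 <= k.
  by rewrite ler_pdivlMr ?mulr_gt0// mul1r mulrC -ler_pdivlMr// alpha_le_ratio.
have [vmin|vn] := pselect (argminW n f W v).
  rewrite (pv vmin) subrr dotvC dotv0l mulr0 add0r.
  move: vmin; rewrite argminWE => -[_ /= h].
  by rewrite (@le_trans _ _ 0) ?subr_le0// mulr_ge0 ?subr_ge0// Delta_ge0.
have h1 := alpha_le Wv vn.
have h2 := tau_wexcess_le Wv Wp.
have pE : excess p <= De by rewrite excessE; lra.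
(* This is [alpha_le] rescaled. Subtracting [De] from [excess v] to recover the risk later turns the
   [k * De] of the next inequality into [(k - 1) * De]. *)
have : excess v <= k * (tau * wexcess v).
  have -> : k * (tau * wexcess v) = Gn / al * wexcess v.
    by rewrite /k; field; rewrite !gt_eqF.
  have -> : excess v = Gn / al * (al * (Gn^-1 * excess v)).
    by field; rewrite !gt_eqF// Gn_gt0.
  by rewrite ler_pM2l// divr_gt0// Gn_gt0.
have : k * (tau * wexcess v) <= k * (dotv (mean_clipped v) (v - p) + De).
  by rewrite ler_pM2l ?(lt_le_trans ltr01)//; lra.
rewrite excessE; lra.
Qed.

End RiskDecomposition.

(** * The three bounds *)

Section StepSize.
Context {R : realType}.
Variables (C tau phi : R) (T : nat).
Hypotheses (C0 : 0 < C) (tau0 : 0 < tau) (T0 : (0 < T)%N).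

Local Notation s := (Num.sqrt (T%:R^-1 + phi ^+ 2)).
Local Notation eta := (C / (T%:R * tau) * s^-1).

Let T_gt0 : 0 < T%:R :> R. Proof. by rewrite ltr0n. Qed.

Lemma radius_gt0 : 0 < s.
Proof. by rewrite sqrtr_gt0 ltr_wpDr ?sqr_ge0// invr_gt0. Qed.

Lemma step_size_gt0 : 0 < eta.
Proof. by rewrite !mulr_gt0// ?invr_gt0 ?mulr_gt0// radius_gt0. Qed.

(* [S] is the sum over iterations, [D] the squared initial distance, [N] the trace of the noise covariance. *)
Lemma step_size_bound (S D N : R) : N = T%:R * tau ^+ 2 * phi ^+ 2 ->
  2 * eta * S <= D + T%:R * (eta ^+ 2 * (2 * tau ^+ 2 + 2 * N)) ->
  T%:R^-1 * S <= (D / (2 * C) + C) * tau * s.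
Proof.
move=> ->; have s0 := radius_gt0.
have s2 : T%:R^-1 + phi ^+ 2 = s ^+ 2.
  by rewrite sqr_sqrtr// addr_ge0 ?sqr_ge0// invr_ge0 ltW.
(* The bracket equals 2 tau^2 T s^2 and [eta] carries the factor 1 / (T tau s), so the accumulated
   error depends on [C] alone. *)
have -> : T%:R * (eta ^+ 2 * (2 * tau ^+ 2 + 2 * (T%:R * tau ^+ 2 * phi ^+ 2)))
    = 2 * C ^+ 2.
  have -> : 2 * tau ^+ 2 + 2 * (T%:R * tau ^+ 2 * phi ^+ 2)
      = 2 * tau ^+ 2 * T%:R * s ^+ 2.
    by rewrite -s2; field; rewrite gt_eqF.
  by field; rewrite !gt_eqF.
move=> h.
have -> : T%:R^-1 * S = (2 * eta * S) * (tau * s / (2 * C)).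
  by field; rewrite !gt_eqF.
have -> : (D / (2 * C) + C) * tau * s = (D + 2 * C ^+ 2) * (tau * s / (2 * C)).
  by field; rewrite gt_eqF.
by rewrite ler_pM2r// divr_gt0 ?mulr_gt0.
Qed.

End StepSize.

Theorem mainTheorem1 (R : realType) (d n : nat)
  (f : nat -> 'rV[R]_d -> R) (gf : nat -> 'rV[R]_d -> 'rV[R]_d)
  (W : set 'rV[R]_d) (proj : 'rV[R]_d -> 'rV[R]_d) (wstar w0 : 'rV[R]_d)
  (C tau b eps delta nu : R) (T : nat)
  (d0 : measure_display) (Omega : measurableType d0) (P : probability Omega R)
  (B : nat -> nat -> Omega -> bool) (Z : nat -> nat -> Omega -> R)
  (that : Omega -> nat) :
  (0 < n)%N ->
  (forall i, (i < n)%N -> is_convex_fun (f i) /\ has_gradient (f i) (gf i)) ->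
  is_convex_set W -> is_proj W proj -> W w0 ->
  W wstar -> (forall w, W w -> favg n f wstar <= favg n f w) ->
  0 < C -> (1 <= T)%N -> 0 < tau -> 1 <= b <= n%:R ->
  0 < eps -> 0 < delta < 1 -> 0 < nu ->
  let phi := Num.sqrt (nu * d%:R * ln delta^-1) / (n%:R * eps) in
  let eta := C / (T%:R * tau) * (Num.sqrt (T%:R^-1 + phi ^+ 2))^-1 in
  let sigma := Num.sqrt (nu * T%:R * ln delta^-1 * tau ^+ 2 / (n%:R ^+ 2 * eps ^+ 2)) in
  dpsgd_randomness P n d T b sigma B Z that ->
  let wpriv := fun o : Omega =>
    dpsgd_iter n gf proj eta tau b (fun t i => B t i o) (fun t j => Z t j o) w0 (that o) in
  let OR := ('E_P[fun o => favg n f (wpriv o)] - (favg n f wstar)%:E)%E in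
  (* part 1 *)
  ((n%:R^-1)%:E * \sum_(i < n)
       'E_P[fun o => (clipfac tau (gf i (wpriv o)) * (f i (wpriv o) - f i wstar))%R]
     <= ((enorm (w0 - wstar) ^+ 2 / (2 * C) + C) * tau
         * Num.sqrt (T%:R^-1 + phi ^+ 2))%:E)%E
  /\
  (* part 2 *)
  (forall (G fstar : nat -> R),
     0 < G 0%N -> (forall i j, (i < j)%N -> (j < n)%N -> G i < G j) ->
     (forall i w, (i < n)%N -> W w -> enorm (gf i w) <= G i) ->
     (forall i, (i < n)%N ->
        (exists u, W u /\ f i u = fstar i) /\ (forall w, W w -> fstar i <= f i w)) ->
     tau <= G n.-1 ->
     (exists w, W w /\ ~ argminW n f W w) ->
     let al := alpha n f fstar G W tau in
     let De := Delta n f fstar wstar in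
     0 <= De /\ 1 <= al /\
     (OR <= (al^-1 * ((enorm (w0 - wstar) ^+ 2 / (2 * C) + C) * G n.-1
                      * Num.sqrt (T%:R^-1 + phi ^+ 2))
             + (G n.-1 / (tau * al) - 1) * De)%:E)%E)
  /\
  (* part 3: T = 1/(3 phi^2) *)
  (forall (G fstar : nat -> R),
     0 < G 0%N -> (forall i j, (i < j)%N -> (j < n)%N -> G i < G j) ->
     (forall i w, (i < n)%N -> W w -> enorm (gf i w) <= G i) ->
     (forall i, (i < n)%N ->
        (exists u, W u /\ f i u = fstar i) /\ (forall w, W w -> fstar i <= f i w)) ->
     tau <= G n.-1 ->
     (exists w, W w /\ ~ argminW n f W w) ->
     T%:R = (3 * phi ^+ 2)^-1 ->
     let al := alpha n f fstar G W tau in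
     let De := Delta n f fstar wstar in
     (OR <= (al^-1 * ((enorm (w0 - wstar) ^+ 2 / C + 2 * C) * G n.-1 * phi)
             + (G n.-1 / (tau * al) - 1) * De)%:E)%E).
Proof.
move=> n0 hf Wconv Wproj Ww0 Wws wsmin C0 T1 tau0 /andP[b1 bn] eps0 /andP[de0 de1] nu0.
move=> phi eta sigma rnd wpriv OR.
have hgr i : (i < n)%N -> has_gradient (f i) (gf i) by move=> /hf[].
have eta0 : 0 < eta by exact: step_size_gt0.
have n_gt0 : 0 < n%:R :> R by rewrite ltr0n.
have T_gt0 : 0 < T%:R :> R by rewrite ltr0n.
have lnd : 0 < ln delta^-1 by rewrite ln_gt0// invf_gt1.
have sig2 : 0 < nu * T%:R * ln delta^-1 * tau ^+ 2 / (n%:R ^+ 2 * eps ^+ 2).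
  by rewrite divr_gt0 ?mulr_gt0 ?exprn_gt0.
have sigma0 : 0 < sigma by rewrite sqrtr_gt0.
(* This explains [phi]: relative to tau^2, the total noise variance of one step is T phi^2, which
   combines with the batch term 1 into T (1/T + phi^2). *)
have noiseE : d%:R * sigma ^+ 2 = T%:R * tau ^+ 2 * phi ^+ 2.
  rewrite /sigma /phi expr_div_n !sqr_sqrtr ?(ltW sig2)//; last first.
    by rewrite !mulr_ge0// ltW.
  by field; rewrite !gt_eqF.
pose w := iterate (n := n) gf proj w0 eta tau b B Z.
pose r := Num.sqrt (T%:R^-1 + phi ^+ 2).
pose A := enorm (w0 - wstar) ^+ 2 / (2 * C) + C.
have r0 : 0 < r by exact: radius_gt0.
have mw t : (t < T)%N -> measurable_vec (w t :
    g_sigma_algebraType (cylinders (rv_relevant n d T) (rv_family B Z that) (before t)) -> _).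
  by move=> tT; exact: (measurable_iterate w0 eta b tau0 hgr Wconv Wproj (ltnW tT)).
(* Common to both bounds. The growth constants [K] and [L] give integrability, and the condition at
   [w0] allows the initial gap to be measured from [wstar] whatever [pi] is. *)
have key (pi : 'rV[R]_d -> 'rV[R]_d) (h : 'rV[R]_d -> R) (k c K L : R) :
    (forall z, W (pi z)) ->
    (forall y z, enorm (pi y - pi z) <= enorm (y - z)) ->
    (forall y z, enorm (z - pi z) <= enorm (z - pi y)) ->
    enorm (w0 - pi w0) <= enorm (w0 - wstar) ->
    0 <= k -> 0 <= K ->
    (forall x, W x -> `|h x| <= K * enorm (x - wstar) + L) ->
    (forall t, (t < T)%N -> measurable_fun setT ((fun o => h (w t o)) :
      g_sigma_algebraType (cylinders (rv_relevant n d T) (rv_family B Z that) (before t)) -> R)) ->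
    (forall x, W x ->
      h x <= k * dotv (mean_clipped_grad n gf tau x) (x - pi x) + c) ->
    ('E_P[fun o => h (wpriv o)] = (T%:R^-1 * \sum_(t < T) \int[P]_o h (w t o))%:E)%E
    /\ T%:R^-1 * (\sum_(t < T) \int[P]_o h (w t o)) <= k * (A * tau * r) + c.
  move=> piW pine pid pi0 k0 K0 hK mh hk.
  have ih t : (t < T)%N -> rintegrable P (fun o => h (w t o)).
    move=> tT.
    apply: (rintegrable_iterate n0 tau0 b1 (ltW eta0) sigma0 hgr Wconv Wproj Ww0 rnd
      Wws K0 hK (ltnW tT)).
    exact: (measurable_iterateT rnd (mh t tT)).
  split; first exact: (expectation_output rnd T1 mh ih).
  apply: le_trans (mean_descent_le n0 tau0 b1 (ltW eta0) sigma0 hgr Wconv Wproj Ww0 rnd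
    piW pine pid k0 T1 hk ih) _.
  rewrite lerD2r ler_wpM2l//.
  have := sum_descent_le w0 n0 tau0 b1 (ltW eta0) sigma0 hgr Wconv Wproj rnd piW pine pid.
  rewrite -(mulrA 2 d%:R) => /(step_size_bound C0 tau0 T1 noiseE) /le_trans; apply.
  rewrite ler_wpM2r ?(ltW r0)// ler_wpM2r ?(ltW tau0)// lerD2r.
  rewrite ler_pM2r ?invr_gt0 ?mulr_gt0// -sqr_enorm.
  by rewrite ler_pXn2r ?nnegrE ?enorm_ge0.
have part1 : ((n%:R^-1)%:E * \sum_(i < n)
       'E_P[fun o => (clipfac tau (gf i (wpriv o)) * (f i (wpriv o) - f i wstar))%R]
     <= (A * tau * r)%:E)%E.

  pose h i x := clipfac tau (gf i x) * (f i x - f i wstar).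
  have hle i x : (i < n)%N -> h i x <= dotv (clip (gf i x) tau) (x - wstar).
    move=> ni; have [fc fg] := hf i ni.
    rewrite /h clipE dotvZl ler_wpM2l ?clipfac_ge0//.
    have := convex_gradient_le fg x wstar fc.
    by rewrite -(opprB x wstar) dotvNr; lra.
  (* Gradients may be unbounded in this part. Linear growth of [h i] comes from clipping on one side
     and, on the other, from the tangent to [f i] at [wstar], the clipping factor being at most
     1. *)
  have hge i x : (i < n)%N -> - (enorm (gf i wstar) * enorm (x - wstar)) <= h i x.
    move=> ni; have [fc fg] := hf i ni.
    have := convex_gradient_le fg wstar x fc.
    have := normr_dotv_le (gf i wstar) (x - wstar); rewrite ler_norml => /andP[h1 _] h2.
    have h3 : - (enorm (gf i wstar) * enorm (x - wstar)) <= f i x - f i wstar by lra.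
    have c0 := clipfac_ge0 tau0 (gf i x); have c1 := clipfac_le1 tau0 (gf i x).
    apply: le_trans (ler_wpM2l c0 h3).
    by rewrite mulrN lerN2 ler_piMl// mulr_ge0 ?enorm_ge0.
  have habs i x : (i < n)%N ->
      `|h i x| <= (tau + enorm (gf i wstar)) * enorm (x - wstar) + 0.
    move=> ni; rewrite addr0 ler_norml.
    have t1 : 0 <= tau * enorm (x - wstar) by rewrite mulr_ge0 ?enorm_ge0 ?ltW.
    have t2 : 0 <= enorm (gf i wstar) * enorm (x - wstar) by rewrite mulr_ge0 ?enorm_ge0.
    have := hge i x ni.
    have : dotv (clip (gf i x) tau) (x - wstar) <= tau * enorm (x - wstar).
      by apply: le_trans (dotv_le _ _) _; rewrite ler_wpM2r ?enorm_ge0 ?enorm_clip_le.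
    by have := hle i x ni; lra.
  have mh i t : (i < n)%N -> (t < T)%N -> measurable_fun setT ((fun o => h i (w t o)) :
      g_sigma_algebraType (cylinders (rv_relevant n d T) (rv_family B Z that) (before t)) -> R).
    move=> ni tT; have mwt := mw t tT; apply: measurable_funM.
      exact: (measurable_continuous_comp (measurable_gradient (hgr i ni) mwt)
        (continuous_clipfac tau0)).
    apply: measurable_funB; last exact: measurable_cst.
    exact: (measurable_continuous_comp mwt (has_gradient_continuous (hgr i ni))).
  have ih i t : (i < n)%N -> (t < T)%N -> rintegrable P (fun o => h i (w t o)).
    move=> ni tT.
    apply: (rintegrable_iterate n0 tau0 b1 (ltW eta0) sigma0 hgr Wconv Wproj Ww0 rnd
      Wws _ (fun x _ => habs i x ni) (ltnW tT)).
      by rewrite addr_ge0 ?enorm_ge0// ltW.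
    exact: (measurable_iterateT rnd (mh i t ni tT)).
  have Eh (i : 'I_n) : ('E_P[fun o => (clipfac tau (gf i (wpriv o)) *
      (f i (wpriv o) - f i wstar))%R] =
      (T%:R^-1 * \sum_(t < T) \int[P]_o h i (w t o))%:E)%E.
    exact: (expectation_output (h := h i) rnd T1 (fun t => mh i t (ltn_ord i))
      (fun t => ih i t (ltn_ord i))).
  rewrite (eq_bigr _ (fun i _ => Eh i)) sumEFin -EFinM lee_fin.
  pose H x := n%:R^-1 * \sum_(i < n) h i x.
  have HE : n%:R^-1 * (\sum_(i < n) T%:R^-1 * \sum_(t < T) \int[P]_o h i (w t o))
      = T%:R^-1 * \sum_(t < T) \int[P]_o H (w t o).
    rewrite -mulr_sumr mulrCA exchange_big /=; congr (_ * _); rewrite mulr_sumr.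
    apply: eq_bigr => t _.
    have is_ : rintegrable P (fun o => \sum_(i < n) h i (w t o)).
      by apply: rintegrable_sum => i _; exact: ih.
    by rewrite RintegralZl// Rintegral_sum// => i _; exact: ih.
  have pine (y z : 'rV[R]_d) : enorm (wstar - wstar) <= enorm (y - z).
    by rewrite subrr enorm0 enorm_ge0.
  have K0 : 0 <= n%:R^-1 * \sum_(i < n) (tau + enorm (gf i wstar)).
    apply: mulr_ge0; first by rewrite invr_ge0 ltW.
    by apply: sumr_ge0 => i _; rewrite addr_ge0 ?enorm_ge0// ltW.
  have := key (fun=> wstar) H 1 0 _ 0 (fun=> Wws) pine (fun y z => lexx _)
    (lexx _) ler01 K0.
  case=> [x Wx|t tT|x Wx|_].
  - rewrite addr0 /H normrM gtr0_norm ?invr_gt0// -mulrA ler_pM2l ?invr_gt0//.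
    rewrite mulr_suml; apply: le_trans (ler_norm_sum _ _ _) _.
    by apply: ler_sum => i _; rewrite -[leRHS]addr0 habs.
  - apply: measurable_funM; first exact: measurable_cst.
    by apply: measurable_sum => i; exact: mh.
  - rewrite mul1r addr0 /H dotvZl ler_pM2l ?invr_gt0// dotv_suml.
    by apply: ler_sum => i _; exact: hle.
  by rewrite mul1r addr0 HE.
have part2 (G fstar : nat -> R) :
     0 < G 0%N -> (forall i j, (i < j)%N -> (j < n)%N -> G i < G j) ->
     (forall i w, (i < n)%N -> W w -> enorm (gf i w) <= G i) ->
     (forall i, (i < n)%N ->
        (exists u, W u /\ f i u = fstar i) /\ (forall w, W w -> fstar i <= f i w)) ->
     tau <= G n.-1 ->
     (exists w, W w /\ ~ argminW n f W w) ->
     let al := alpha n f fstar G W tau in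
     let De := Delta n f fstar wstar in
     0 <= De /\ 1 <= al /\
     (OR <= (al^-1 * (A * G n.-1 * r) + (G n.-1 / (tau * al) - 1) * De)%:E)%E.
  move=> G0 Ginc Gb fsP tauG nonmin al De.
  have De0 : 0 <= De := Delta_ge0 n0 Wws fsP.
  have al1 : 1 <= al := alpha_ge1 n0 Wws wsmin tau0 G0 Ginc fsP tauG nonmin.
  have al0 : 0 < al := lt_le_trans ltr01 al1.
  have Gn0 : 0 < G n.-1 := Gn_gt0 n0 G0 Ginc.
  split=> //; split=> //.
  have Wcl : closed W := is_proj_closed Wconv Wproj.
  have [pi piP] := closed_exists_proj (argminW_closed hf Wws wsmin Wcl)
    (ex_intro _ wstar (conj Wws wsmin)).
  have amconv := argminW_convex n0 hf Wws wsmin Wconv.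
  have amW z : argminW n f W (pi z) by exact: (projP piP).
  have piW z : W (pi z) by case: (amW z).
  have pid y z : enorm (z - pi z) <= enorm (z - pi y).
    by case: (piP z) => _; apply.
  have pi0 : enorm (w0 - pi w0) <= enorm (w0 - wstar).
    by case: (piP w0) => _; apply.
  have k0 : 0 <= G n.-1 / (tau * al) by rewrite divr_ge0 ?mulr_ge0 ?ltW.
  (* The function is [favg n f] itself, so its value at [wstar] belongs to the additive constant and
     cancels in [OR]. *)
  have := key pi (favg n f) (G n.-1 / (tau * al))
    ((G n.-1 / (tau * al) - 1) * De + favg n f wstar) (G n.-1) `|favg n f wstar|
    piW (proj_nonexpansive amconv piP) pid pi0 k0 (ltW Gn0).
  case=> [x Wx|t tT|x Wx|mE mle].
  - rewrite -[X in `|X|](subrK (favg n f wstar)).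
    rewrite (le_trans (ler_normD _ _))// lerD2r.
    rewrite /favg -mulrBr -sumrB normrM gtr0_norm ?invr_gt0// mulrC ler_pdivrMr//.
    apply: le_trans (ler_norm_sum _ _ _) _.
    have -> : G n.-1 * enorm (x - wstar) * n%:R = \sum_(i < n) G n.-1 * enorm (x - wstar).
      by rewrite sumr_const card_ord mulr_natr.
    apply: ler_sum => i _; have ni := ltn_ord i; have [fc fg] := hf i ni.
    apply: le_trans (_ : G i * enorm (x - wstar) <= _); last first.
      by rewrite ler_wpM2r ?enorm_ge0// (G_le n0 Ginc).
    (* The tangent inequality at both points makes [f i] Lipschitz on [W] with constant [G i], which
       gives the linear growth asked for by [key]. *)
    have grad_le y z : W y -> f i y - f i z <= G i * enorm (y - z).
      move=> Wy; have := convex_gradient_le fg y z fc; rewrite -(opprB y z) dotvNr => h.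
      apply: le_trans (_ : dotv (gf i y) (y - z) <= _); first by lra.
      apply: le_trans (dotv_le _ _) _; rewrite ler_wpM2r ?enorm_ge0//; exact: Gb.
    have h1 := grad_le x wstar Wx; have h2 := grad_le wstar x Wws.
    by rewrite enormBC in h2; rewrite ler_norml; lra.
  - exact: (measurable_continuous_comp (mw t tT) (favg_continuous hf)).
  - rewrite addrA -lerBlDr; apply: risk_le => //.
    by move=> vmin; exact: (proj_id piP).
  rewrite /OR mE -EFinB lee_fin.
  have -> : al^-1 * (A * G n.-1 * r) = G n.-1 / (tau * al) * (A * tau * r).
    by field; rewrite !gt_eqF.
  lra.
split; first exact: part1.
split=> [|G fstar G0 Ginc Gb fsP tauG nonmin TE]; first exact: part2.
set al := alpha n f fstar G W tau.
have [_ [_ h]] := part2 G fstar G0 Ginc Gb fsP tauG nonmin.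
suff E : al^-1 * (A * G n.-1 * r)
   = al^-1 * ((enorm (w0 - wstar) ^+ 2 / C + 2 * C) * G n.-1 * phi) by move: h; rewrite -/al E.
have phi0 : 0 <= phi.
  by rewrite divr_ge0 ?sqrtr_ge0// ltW// mulr_gt0.
(* Here 1/T = 3 phi^2, so the radicand is 4 phi^2. *)
have rE : r = 2 * phi.
  rewrite /r TE invrK (_ : 3 * phi ^+ 2 + phi ^+ 2 = (2 * phi) ^+ 2); last by ring.
  by rewrite sqrtr_sqr ger0_norm// mulr_ge0.
by rewrite /A rE; congr (_ * _); field; rewrite gt_eqF.
Qed.
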